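(* Let $m_3\in\mathbb{N}$. For any centered Gaussian random vector $(X_1,X_2,X_3)$, $$E[X_1^{2}X_2^{4}X_3^{2m_3}]\ge E[X_1^{2}]\,E[X_2^{4}]\,E[X_3^{2m_3}]$$ and $$E[X_1^{2}X_2^{6}X_3^{2m_3}]\ge E[X_1^{2}]\,E[X_2^{6}]\,E[X_3^{2m_3}].$$ In each of these two inequalities, equality holds if and only if $X_1,X_2,X_3$ are independent.
   Context: $\mathbb{N}=\{1,2,3,\dots\}$. A centered Gaussian random vector is a jointly Gaussian vector with mean zero; its covariance matrix may be singular (the components may be linearly dependent). Standing assumption: every Gaussian random variable is real-valued and non-zero, i.e. each component of a Gaussian random vector has strictly positive variance. *)

(* Defs.v *)
From HB Require Import structures.
From mathcomp Require Import all_boot all_order all_algebra.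
From mathcomp Require Import all_classical all_reals all_analysis.

Set Implicit Arguments.
Unset Strict Implicit.
Unset Printing Implicit Defensive.

Import Order.TTheory GRing.Theory Num.Theory.

Local Open Scope classical_set_scope.
Local Open Scope ring_scope.

(* A point mass counts as a (degenerate) Gaussian law. It needs a separate
   clause, since [normal_prob m 0] is by convention the uniform law on [0, 1].
   The laws are compared on measurable sets only: outside the sigma-algebra the
   values of these set functions carry no meaning. *)
Definition gaussian_rv (d : measure_display) (T : measurableType d)
    (R : realType) (P : probability T R) (Y : {RV P >-> R}) : Prop :=
  exists m : R,
    (exists2 s : R, 0 < s &
       forall A : set R, measurable A ->
         distribution P Y A = normal_prob m s A)
    \/ (forall A : set R, measurable A -> distribution P Y A = \d_m A).
Arguments gaussian_rv {d T R} P Y.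

(* Joint Gaussianity: every linear combination is Gaussian. The covariance
   matrix may be singular. *)
Definition gaussian_vector (d : measure_display) (T : measurableType d)
    (R : realType) (P : probability T R) (n : nat)
    (X : 'I_n -> {RV P >-> R}) : Prop :=
  forall a : 'I_n -> R,
    gaussian_rv P (\sum_(i < n) a i *: X i : {mfun T >-> R}).
Arguments gaussian_vector {d T R} P {n} X.

Definition centered_vector (d : measure_display) (T : measurableType d)
    (R : realType) (P : probability T R) (n : nat)
    (X : 'I_n -> {RV P >-> R}) : Prop :=
  forall i, ('E_P[X i] = 0)%E.
Arguments centered_vector {d T R} P {n} X.

Definition nondegenerate_vector (d : measure_display) (T : measurableType d)
    (R : realType) (P : probability T R) (n : nat)
    (X : 'I_n -> {RV P >-> R}) : Prop :=
  forall i, (0 < 'V_P[X i])%E.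
Arguments nondegenerate_vector {d T R} P {n} X.

(* Mutual independence, as the product rule over every subfamily. *)
Definition independent_rvs (d : measure_display) (T : measurableType d)
    (R : realType) (P : probability T R) (n : nat)
    (X : 'I_n -> {RV P >-> R}) : Prop :=
  forall (J : {set 'I_n}) (A : 'I_n -> set R),
    (forall i, measurable (A i)) ->
    P (\bigcap_(i in [set` J]) (X i @^-1` A i)) =
      (\prod_(i in J) P (X i @^-1` A i))%E.
Arguments independent_rvs {d T R} P {n} X.

(* Main.v *)
Require Import Defs.
From HB Require Import structures.
From mathcomp Require Import all_boot all_order all_algebra.
From mathcomp Require Import all_classical all_reals all_analysis.
From mathcomp Require Import measurable_realfun ring lra.

Set Implicit Arguments.
Unset Strict Implicit.
Unset Printing Implicit Defensive.

Import Order.TTheory GRing.Theory Num.Theory.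
Import numFieldNormedType.Exports.
Import HBNNSimple.

Local Open Scope classical_set_scope.
Local Open Scope ring_scope.

(** By linear regression, [X2 = beta X3 + U] and [X1 = b X3 + e U + V] with
    [X3, U, V] jointly Gaussian and uncorrelated, hence independent. Divided by
    [E[X3^N]], the difference of the two sides is then
    [E[V^2] W + b^2 v A + e^2 u B + 2 b e beta v u D] with [v = E[X3^2]],
    [u = E[U^2]], where [A, B, D, W] are polynomials in [N], [x = beta^2 v] and
    [u]. For every [N > 0] one has [A > 0], [A B > x u D^2] and [W >= 0], with
    [W = 0] only if [x = 0]: the difference is nonnegative, and it vanishes only
    if [X1, X2, X3] are uncorrelated.

    That uncorrelated jointly Gaussian variables are independent follows from
    [E[cos (Y + t)] = cos t * exp (- E[Y^2] / 2)]: the factorisation of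
    [E[f(X) g(U) h(V)]] holds for cosines, and it is preserved by linear
    combinations and by limits dominated by a polynomial. The closure of the
    cosines under these operations contains the monomials and the indicators of
    all Borel sets. *)

(** * Moments of the normal law *)

(** The covariance matrix may be singular, so no joint density is available. Only the laws of single
    linear combinations [Y] are used, and of these only that all powers are integrable, that the
    mean is zero, and the recursion [E[Y^(k+2)] = (k+1) E[Y^2] E[Y^k]], which also holds when [Y]
    vanishes almost surely. The regression is on [X3] because its exponent is the arbitrary one: the
    ratios [E[X3^(N+k)] / E[X3^N]] are polynomials in [N], and only [k <= 8] occurs. The exponent 2
    of [X1] makes the difference quadratic in [(b, e)], with determinant [v u (A B - x u D^2)]; this
    is where the condition on [A], [B], [D] comes from. When the difference vanishes, [V] carries
    the whole variance of [X1], which is positive, so that [W = 0]. Conversely, to get zero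
    covariances from independence, a product rule on events must be carried over to products of
    unbounded variables. The same closure, now generated by indicators, does this. *)

Lemma ge0_integral_normal_prob (R : realType) (m s : R) (f : R -> \bar R) :
  measurable_fun [set: R] f -> (forall x, 0 <= f x)%E ->
  (\int[normal_prob m s]_x f x =
   \int[lebesgue_measure]_x (f x * (normal_pdf m s x)%:E))%E.
Proof.
move=> mf f0.
have dom := @normal_prob_dominates R m s.
rewrite -(Radon_Nikodym_SigmaFinite.change_of_variables dom)//=.
have fi := Radon_Nikodym_SigmaFinite.f_integrable dom.
apply: ae_eq_integral => //.
- apply: emeasurable_funM => //; exact: (measurable_int lebesgue_measure).
- apply: emeasurable_funM => //=; apply/measurableT_comp => //=.
  exact: measurable_normal_pdf.
(* The Radon-Nikodym derivative and [normal_pdf] have the same integral over every measurable set,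
   hence agree almost everywhere. *)
- apply: ae_eqe_mul2l => /=.
  apply: integral_ae_eq => //=.
  + by apply/measurableT_comp => //; exact: measurable_normal_pdf.
  + move=> E E01 mE; rewrite -Radon_Nikodym_SigmaFinite.f_integral//.
Qed.

Lemma integrable_normal_prob (R : realType) (m s : R) (f : R -> R) :
  measurable_fun setT f ->
  lebesgue_measure.-integrable setT
    (EFin \o (fun x => f x * normal_pdf m s x)) ->
  (normal_prob m s).-integrable setT (EFin \o f).
Proof.
move=> mf /integrableP[_ intf]; apply/integrableP; split; first exact/measurable_EFinP.
rewrite ge0_integral_normal_prob//; last exact/measurableT_comp/measurable_EFinP.
under eq_integral do rewrite /= -EFinM -{1}(ger0_norm (normal_pdf_ge0 m s _)) -normrM.
exact: intf.
Qed.

Lemma integral_normal_prob (R : realType) (m s : R) (f : R -> R) :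
  measurable_fun setT f ->
  lebesgue_measure.-integrable setT
    (EFin \o (fun x => f x * normal_pdf m s x)) ->
  (\int[normal_prob m s]_x (f x)%:E =
   \int[lebesgue_measure]_x (f x * normal_pdf m s x)%:E)%E.
Proof.
move=> mf intf.
have mfe : measurable_fun setT (EFin \o f) by exact/measurable_EFinP.
rewrite integralE [RHS]integralE; congr (_ - _)%E.
  rewrite ge0_integral_normal_prob//; last exact: measurable_funepos.
  apply: eq_integral => x _; rewrite !funeposE -!EFin_max -EFinM.
  by rewrite maxr_pMl ?mul0r ?normal_pdf_ge0.
rewrite ge0_integral_normal_prob//; last exact: measurable_funeneg.
apply: eq_integral => x _; rewrite !funenegE -!EFinN -!EFin_max -EFinM.
by rewrite maxr_pMl ?mul0r ?normal_pdf_ge0// mulNr.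
Qed.

Section improper.
Context {R : realType}.
Local Notation mu := (@lebesgue_measure R).

(** Fundamental theorem of calculus on growing symmetric intervals, combined with dominated
    convergence. It stands in for integration by parts on the whole line. *)
Lemma Rintegral_derive_eq0 (F f : R -> R) :
  (forall x : R, is_derive x 1 F (f x)) -> continuous f ->
  mu.-integrable setT (EFin \o f) ->
  F n%:R @[n --> \oo] --> 0 -> F (- n%:R) @[n --> \oo] --> 0 ->
  (\int[mu]_x (f x)%:E = 0)%E.
Proof.
move=> dF cf intf Fy FNy.
have mf : measurable_fun setT f by exact: continuous_measurable_fun.
have cF : continuous F.
  by move=> x; apply/differentiable_continuous/derivable1_diffP; have := dF x.
(* With [n.+1] the endpoints are distinct already at [n = 0], as the fundamental theorem
   requires. *)
pose J n : set R := `[- n.+1%:R, n.+1%:R]%classic.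
have FTC n : (\int[mu]_x ((f \_ (J n)) x)%:E = (F n.+1%:R - F (- n.+1%:R))%:E)%E.
  rewrite EFinB -(@continuous_FTC2 _ f F) //.
  - rewrite [RHS]integral_mkcond/=; apply: eq_integral => x _.
    by rewrite restrict_EFin.
  - by rewrite -subr_gt0 opprK -natrD ltr0n.
  - exact: continuous_subspaceT.
  - split.
    + by move=> x _; have := dF x.
    + exact/cvg_at_right_filter/cF.
    + exact/cvg_at_left_filter/cF.
  - by move=> x _; rewrite derive1E; apply: derive_val.
have lim0 : (\int[mu]_x ((f \_ (J n)) x)%:E)%E @[n --> \oo] --> 0%E.
  under eq_cvg do rewrite FTC.
  apply: cvg_EFin; first exact: nearW.
  rewrite -[X in _ --> X](subr0 (0 : R)).
  by apply: cvgB; [move: Fy|move: FNy]; rewrite -cvg_shiftS.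
have limf : (\int[mu]_x ((f \_ (J n)) x)%:E)%E @[n --> \oo] -->
    (\int[mu]_x (f x)%:E)%E.
  apply: (@dominated_cvg _ _ _ mu setT _ _ _ (fun x => `|f x|%:E)) => //.
  - move=> n; apply/measurable_EFinP.
    have mJ : measurable (J n) by exact: measurable_itv.
    by apply: (measurable_restrictT f mJ).1; exact: measurable_funTS.
  - move=> x _; apply: cvg_near_cst.
    near=> n; rewrite patchE ifT// inE /J/= in_itv/= -ler_norml.
    near: n.
    have [N xN] : exists N : nat, `|x| <= N%:R.
      by exists (Num.Def.archi_bound `|x|); exact/ltW/archi_boundP.
    exists N => // n /= Nn; apply: le_trans xN _; rewrite ler_nat.
    exact: leq_trans Nn _.
  - exact: integrable_norm.
  - by move=> n x _; rewrite lee_fin patchE; case: ifP => _ //; rewrite normr0.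
exact: cvg_unique limf lim0.
Unshelve. all: by end_near. Qed.
End improper.

Lemma exprn_le_fact_expR (R : realType) (k : nat) (t : R) :
  0 <= t -> t ^+ k <= k`!%:R * expR t.
Proof.
case: k => [|k] t0.
  by rewrite expr0 mul1r -[leLHS]expR0 ler_expR.
rewrite mulrC -ler_pdivrMr ?ltr0n ?fact_gt0//.
by apply: le_trans (expR_ge1Dxn k t0); rewrite lerDr.
Qed.

Section normal_moments.
Context {R : realType}.
Local Notation mu := (@lebesgue_measure R).
Variables (m s : R).
Hypothesis s_gt0 : 0 < s.
Local Notation phi := (normal_pdf m s).

Let s0 : s != 0. Proof. by rewrite gt_eqF. Qed.

(* Three quarters of the exponent of the density absorbs the power; what remains is
   bounded by the density of standard deviation [2 s]. *)
Lemma even_moment_normal_pdf_le k : exists2 C : R, 0 <= C &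
  forall x, (x - m) ^+ (k.*2) * phi x <= C * normal_pdf m (2 * s) x.
Proof.
have ss0 : 2 * s != 0 by rewrite mulf_neq0.
have p1 := normal_peak_gt0 s0; have p2 := normal_peak_gt0 ss0.
pose c : R := 8 * s ^+ 2 / 3.
have c0 : 0 < c by rewrite divr_gt0// mulr_gt0// exprn_gt0.
exists (c ^+ k * k`!%:R * normal_peak s / normal_peak (2 * s)).
  by rewrite !mulr_ge0 ?invr_ge0 ?exprn_ge0// ltW.
move=> x; rewrite !normal_pdfE// /normal_fun.
set q := normal_peak (2 * s) in p2 *; set p := normal_peak s in p1 *.
set g := expR (_ / ((2 * s) ^+ 2 *+ 2)).
pose t := (x - m) ^+ 2 / c.
have t0 : 0 <= t by rewrite divr_ge0 ?sqr_ge0// ltW.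
have -> : - (x - m) ^+ 2 / (s ^+ 2 *+ 2) =
    - t + - (x - m) ^+ 2 / ((2 * s) ^+ 2 *+ 2) by rewrite /t /c; field.
have -> : (x - m) ^+ k.*2 = c ^+ k * t ^+ k.
  by rewrite -exprMn mulrC /t divfK ?gt_eqF// -exprM mul2n.
rewrite expRD -/g expRN.
rewrite [leLHS](_ : _ = c ^+ k * p * g * (t ^+ k / expR t)); last by ring.
rewrite [leRHS](_ : _ = c ^+ k * p * g * k`!%:R); last by field; rewrite gt_eqF.
rewrite ler_wpM2l ?mulr_ge0 ?exprn_ge0 ?expR_ge0 ?(ltW c0) ?(ltW p1)//.
by rewrite ler_pdivrMr ?expR_gt0// exprn_le_fact_expR.
Qed.

(** Reduction to the even exponent by [|y| <= 1 + y ^+ 2] for [y = (x - m) ^+ k]. The right-hand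
    side is both integrable and bounded: the first gives finite moments, the second decay at
    infinity. *)
Lemma moment_normal_pdf_le k : exists2 C : R, 0 <= C &
  forall x, `|(x - m) ^+ k| * phi x <= phi x + C * normal_pdf m (2 * s) x.
Proof.
have [C C0 HC] := even_moment_normal_pdf_le k.
exists C => // x; apply: le_trans (lerD (lexx _) (HC x)).
rewrite -[X in _ <= X + _]mul1r -mulrDl ler_wpM2r ?normal_pdf_ge0//.
rewrite -mul2n mulnC exprM -[(x - m) ^+ k ^+ 2]real_normK ?num_real//.
by have := normr_ge0 ((x - m) ^+ k); nra.
Qed.

Lemma continuous_moment_normal_pdf k :
  continuous (fun x : R => (x - m) ^+ k * phi x).
Proof.
move=> x; apply: cvgM; last exact: continuous_normal_pdf.
apply: (@continuous_comp _ _ _ (fun x => x - m) (fun x => x ^+ k)).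
  by apply: (@cvgB _ R^o); [exact: cvg_id|exact: cvg_cst].
exact: exprn_continuous.
Qed.

Lemma integrable_moment_normal_pdf k :
  mu.-integrable setT (EFin \o (fun x => (x - m) ^+ k * phi x)).
Proof.
have [C C0 HC] := moment_normal_pdf_le k.
have h : mu.-integrable setT
    (EFin \o (fun x => phi x + C * normal_pdf m (2 * s) x)).
  have i1 := integrable_normal_pdf m s.
  have i2 := integrableZl measurableT C (integrable_normal_pdf m (2 * s)).
  exact: (integrableD measurableT i1 i2).
apply: le_integrable h => //.
- apply/measurable_EFinP; apply: continuous_measurable_fun.
  exact: continuous_moment_normal_pdf.
- move=> x _ /=; rewrite lee_fin normrM [`|phi x|]ger0_norm ?normal_pdf_ge0//.
  exact: le_trans (HC x) (ler_norm _).
Qed.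

(** The bound for one more power makes the product at most [K / |u n - m|]. The hypothesis on [u]
    covers the endpoints [n] and [- n] at once. *)
Lemma moment_normal_pdf_cvg0 k (u : R^nat) :
  (forall n, `|u n| = n%:R) ->
  (u n - m) ^+ k * phi (u n) @[n --> \oo] --> 0.
Proof.
move=> un.
have [C C0 HC] := moment_normal_pdf_le k.+1.
have ss0 : 2 * s != 0 by rewrite mulf_neq0.
pose K := normal_peak s + C * normal_peak (2 * s).
have HK x : `|x - m| ^+ k.+1 * phi x <= K.
  rewrite -normrX (le_trans (HC x))// lerD ?normal_pdf_ub//.
  by rewrite ler_wpM2l ?normal_pdf_ub.
apply/cvgr0Pnorm_le => e e0; near=> n.
have d : `|m| + K / e + 1 <= n%:R.
  by near: n; exact: nbhs_infty_ger.
have K0 : 0 <= K by rewrite addr_ge0 ?mulr_ge0 ?normal_peak_ge0.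
have Ke : 0 <= K / e by rewrite divr_ge0 // ltW.
have y1 : K / e + 1 <= `|u n - m|.
  by rewrite (le_trans _ (lerB_dist _ _))// un; lra.
have y0 : 0 < `|u n - m| by lra.
rewrite normrM normrX [`|phi _|]ger0_norm ?normal_pdf_ge0//.
rewrite -(ler_pM2l y0) mulrA -exprS (le_trans (HK _))//.
by rewrite -ler_pdivrMr//; lra.
Unshelve. all: by end_near. Qed.

Lemma is_derive_normal_pdf (x : R) :
  is_derive x 1 phi (- (x - m) / s ^+ 2 * phi x).
Proof.
rewrite normal_pdfE// /normal_fun.
pose f (x : R) : R := - (x - m) ^+ 2 / (s ^+ 2 *+ 2).
have df : is_derive x 1 f (- (x - m) / s ^+ 2).
  by apply: is_derive_eq; rewrite /GRing.scale/= !(mul0r, mulr0); field.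
have de : is_derive x 1 (fun y => normal_peak s * expR (f y))
    (normal_peak s *: ((- (x - m) / s ^+ 2) * expR (f x))).
  apply: (@is_deriveZ _ _ _ (fun y => expR (f y)) (normal_peak s)).
  have := @is_derive1_comp _ expR f x _ _ (is_derive_expR _) df.
  by rewrite mulrC.
apply: (is_derive_eq de); rewrite /f /GRing.scale/=; ring.
Qed.

Lemma is_derive_moment_normal_pdf k (x : R) :
  is_derive x 1 (fun x => (x - m) ^+ k.+1 * phi x)
    (k.+1%:R * ((x - m) ^+ k * phi x) - (x - m) ^+ k.+2 * phi x / s ^+ 2).
Proof.
have dm : is_derive x 1 (fun x : R => (x - m) ^+ k.+1) (k.+1%:R * (x - m) ^+ k).
  have d1 : is_derive x 1 (fun x : R => x - m) 1.
    by apply: is_derive_eq; rewrite oppr0 addr0.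
  have -> : (fun x : R => (x - m) ^+ k.+1) = (fun x : R => x - m) ^+ k.+1.
    by apply/funext => y; rewrite exprfctE.
  by apply: (is_derive_eq (is_deriveX k.+1 d1)); rewrite /GRing.scale/= mulr1.
have := is_deriveM dm (is_derive_normal_pdf x).
move=> h; apply: (is_derive_eq h); rewrite /GRing.scale/= !exprS; field.
exact: s0.
Qed.

(** Integration by parts: the derivative of [(x - m) ^+ k.+1 * phi x] integrates to zero. *)
Lemma moment_normal_pdfS k :
  (\int[mu]_x ((x - m) ^+ k.+2 * phi x) =
   k.+1%:R * s ^+ 2 * \int[mu]_x ((x - m) ^+ k * phi x)).
Proof.
have ik := integrable_moment_normal_pdf.
have i1 : mu.-integrable setT
    (EFin \o (fun x => k.+1%:R * ((x - m) ^+ k * phi x))).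
  exact: (integrableZl measurableT k.+1%:R (ik k)).
have i2 : mu.-integrable setT
    (EFin \o (fun x => (x - m) ^+ k.+2 * phi x / s ^+ 2)).
  exact: (integrableZr measurableT (s ^- 2) (ik k.+2)).
have : \int[mu]_x
    (k.+1%:R * ((x - m) ^+ k * phi x) - (x - m) ^+ k.+2 * phi x / s ^+ 2) = 0.
  rewrite /Rintegral (Rintegral_derive_eq0 (is_derive_moment_normal_pdf k))//.
  - move=> x; apply: (@cvgB _ R^o); apply: cvgM; try exact: cvg_cst.
      exact: continuous_moment_normal_pdf.
    exact: continuous_moment_normal_pdf.
  - exact: (integrableB measurableT i1 i2).
  - by apply: moment_normal_pdf_cvg0 => n; rewrite ger0_norm.
  - by apply: moment_normal_pdf_cvg0 => n; rewrite normrN ger0_norm.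
rewrite RintegralB// (RintegralZl k.+1%:R measurableT (ik k)).
rewrite (RintegralZr (s ^- 2) measurableT (ik k.+2)).
move/eqP; rewrite subr_eq0 => /eqP h.
by rewrite mulrAC h divfK// sqrf_eq0.
Qed.

Lemma moment_normal_pdf1 : \int[mu]_x ((x - m) * phi x) = 0.
Proof.
pose ik := integrable_moment_normal_pdf.
have i1 : mu.-integrable setT (EFin \o (fun x => - (x - m) / s ^+ 2 * phi x)).
  have := integrableZl measurableT (- s ^- 2) (ik 1%N).
  apply: eq_integrable => // x _ /=; rewrite -EFinM; congr EFin.
  by rewrite expr1; ring.
have : \int[mu]_x (- (x - m) / s ^+ 2 * phi x) = 0.
  rewrite /Rintegral (Rintegral_derive_eq0 is_derive_normal_pdf)//.
  - have -> : (fun x => - (x - m) / s ^+ 2 * phi x) =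
        (fun x => (- s ^- 2) * ((x - m) ^+ 1 * phi x)).
      by apply/funext => x; rewrite expr1; ring.
    move=> x; apply: cvgM; first exact: cvg_cst.
    exact: continuous_moment_normal_pdf.
  - have := @moment_normal_pdf_cvg0 0 (fun n => n%:R).
    under eq_cvg do rewrite expr0 mul1r; apply => n; exact: ger0_norm.
  - have := @moment_normal_pdf_cvg0 0 (fun n => - n%:R).
    under eq_cvg do rewrite expr0 mul1r; apply => n.
    by rewrite normrN ger0_norm.
have -> : (fun x => - (x - m) / s ^+ 2 * phi x) =
    (fun x => (- s ^- 2) * ((x - m) ^+ 1 * phi x)).
  by apply/funext => x; rewrite expr1; ring.
rewrite (RintegralZl (- s ^- 2) measurableT (ik 1%N)).
move/eqP; rewrite mulf_eq0 oppr_eq0 invr_eq0 sqrf_eq0 (negbTE s0)/= => /eqP.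
by under eq_Rintegral do rewrite expr1.
Qed.
End normal_moments.

Section law.
Context d (T : measurableType d) (R : realType) (P : probability T R).

(* The library puts [lebesgue_measure], hence [normal_prob], on [measurableTypeR R],
   whose display differs from that of the canonical structure on [R]. *)
Lemma integral_law (nu : {measure set (measurableTypeR R) -> \bar R})
    (Y : {RV P >-> R}) (g : R -> R) :
  (forall A, measurable A -> distribution P Y A = nu A) ->
  measurable_fun setT g -> nu.-integrable setT (EFin \o g) ->
  P.-integrable setT (EFin \o (g \o Y)) /\
  \int[P]_w g (Y w) = \int[nu]_x g x.
Proof.
move=> law mg /integrableP[mge ig].
have mY : measurable_fun [set: T] (Y : T -> measurableTypeR R).
  exact: measurable_funPT Y.
pose Y' : {mfun T >-> measurableTypeR R} :=
  HB.pack (Y : T -> measurableTypeR R) (isMeasurableFun.Build _ _ _ _ _ mY).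
have HE (f : measurableTypeR R -> \bar R) :
    (\int[distribution P Y']_x f x = \int[nu]_x f x)%E.
  by apply: eq_measure_integral => A mA _; exact: law.
have iP : P.-integrable setT (EFin \o (g \o Y)).
  apply/integrableP; split.
    by apply/measurable_EFinP/measurableT_comp.
  apply: le_lt_trans ig.
  rewrite -(HE (fun x => `|(g x)%:E|%E)) ge0_integral_distribution//.
  exact: measurableT_comp.
split => //.
rewrite /Rintegral; congr fine.
by rewrite -(HE (EFin \o g)) integral_distribution.
Qed.

(** This is all that is retained of a centered Gaussian law. The variance is the only parameter of
    the recursion, and a point mass at zero satisfies it too, so that degenerate linear combinations
    need no separate treatment. *)
Definition gaussian_moments (Y : T -> R) :=
  [/\ measurable_fun setT Y,
      forall k, P.-integrable setT (EFin \o (fun w => Y w ^+ k)),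
      \int[P]_w Y w = 0 &
      forall k, \int[P]_w (Y w ^+ k.+2) =
        k.+1%:R * \int[P]_w (Y w ^+ 2) * \int[P]_w (Y w ^+ k)].

Lemma gaussian_rv_centered_moments (Y : {RV P >-> R}) : gaussian_rv P Y ->
  exists m s2 : R, [/\
      forall k, P.-integrable setT (EFin \o (fun w => (Y w - m) ^+ k)),
      \int[P]_w (Y w - m) = 0 &
      forall k, \int[P]_w ((Y w - m) ^+ k.+2) =
        k.+1%:R * s2 * \int[P]_w ((Y w - m) ^+ k)].
Proof.
case=> m [[s s0 law]|law]; exists m.
  have mX k : measurable_fun [set: R] (fun x : R => (x - m) ^+ k).
    by apply: measurable_funX; exact: measurable_funB.
  have iX k := integrable_normal_prob (mX k) (integrable_moment_normal_pdf m s0 k).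
  have H k := integral_law law (mX k) (iX k).
  have E k : \int[P]_w ((Y w - m) ^+ k) =
      \int[lebesgue_measure]_x ((x - m) ^+ k * normal_pdf m s x).
    rewrite (H k).2 /Rintegral integral_normal_prob//.
    exact: integrable_moment_normal_pdf.
  exists (s ^+ 2); split.
  - by move=> k; exact: (H k).1.
  - have := E 1%N; under eq_Rintegral do rewrite expr1.
    under [in RHS]eq_Rintegral do rewrite expr1.
    by rewrite moment_normal_pdf1.
  - by move=> k; rewrite !E moment_normal_pdfS.
have mX k : measurable_fun [set: R] (fun x : R => (x - m) ^+ k).
  by apply: measurable_funX; exact: measurable_funB.
have iX k : (@dirac _ (measurableTypeR R) m R).-integrable setT
    (EFin \o (fun x : R => (x - m) ^+ k)).
  have mXe : measurable_fun [set: measurableTypeR R] (EFin \o (fun x : R => (x - m) ^+ k)).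
    by apply/measurable_EFinP; exact: mX.
  apply/integrableP; split => //.
  rewrite integral_dirac//; last first.
    exact: measurableT_comp (@abse_measurable _ _) mXe.
  by rewrite diracT mul1e ltry.
have H k := @integral_law (@dirac _ (measurableTypeR R) m R) Y _ law (mX k) (iX k).
have E k : \int[P]_w ((Y w - m) ^+ k) = 0 ^+ k.
  rewrite (H k).2 /Rintegral integral_dirac//; last first.
    by apply/measurable_EFinP; exact: mX.
  by rewrite diracT mul1e /= subrr.
exists 0; split.
- by move=> k; exact: (H k).1.
- have := E 1%N; under eq_Rintegral do rewrite expr1.
  by rewrite expr1.
- by move=> k; rewrite !E exprS mul0r mulr0 mul0r.
Qed.

(** Comparing [E[Y - m] = 0] with [E[Y] = 0] gives [m = 0]; the recursion at [k = 0] then identifies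
    its coefficient as [E[Y^2]]. *)
Lemma gaussian_rv_moments (Y : {RV P >-> R}) : gaussian_rv P Y ->
  ('E_P[Y] = 0)%E -> gaussian_moments Y.
Proof.
move=> /gaussian_rv_centered_moments[m [v [iY Y1 YS]]] EY.
have E0 : \int[P]_w (1 : R) = 1.
  by rewrite Rintegral_cst//= mul1r probability_setT.
have mY : measurable_fun setT Y by [].
have m0 : m = 0.
  have EY0 : \int[P]_w Y w = 0 by rewrite /Rintegral -[X in fine X]expectation_def EY.
  have iY1 : P.-integrable setT (EFin \o Y).
    have := iY 1%N; under [X in EFin \o X]eq_fun do rewrite expr1.
    move=> i1; have := integrableD measurableT i1 (finite_measure_integrable_cst P m measurableT).
    by apply: eq_integrable => // w _ /=; rewrite -EFinD subrK.
  have := Y1; rewrite RintegralB// ?EY0 ?sub0r; last exact: finite_measure_integrable_cst.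
  by rewrite Rintegral_cst//= probability_setT mulr1 => /eqP; rewrite oppr_eq0 => /eqP.
have Ym w : Y w - m = Y w by rewrite m0 subr0.
have Yk k : \int[P]_w ((Y w - m) ^+ k) = \int[P]_w (Y w ^+ k).
  by apply: eq_Rintegral => w _; rewrite Ym.
have YS' k : \int[P]_w (Y w ^+ k.+2) = k.+1%:R * v * \int[P]_w (Y w ^+ k).
  by have := YS k; rewrite !Yk.
split => //.
- by move=> k; apply: eq_integrable (iY k) => // w _ /=; rewrite Ym.
- by rewrite -[RHS]Y1; apply: eq_Rintegral => w _; rewrite Ym.
- move=> k; rewrite (YS' 0%N) YS'; under [X in _ = _ * (_ * X) * _]eq_Rintegral do rewrite expr0.
  by rewrite E0 mul1r mulr1.
Qed.
End law.

(** * Characteristic function of a Gaussian variable *)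

Section taylor.
Context {R : realType}.

Lemma is_derive_exprn_fact k (y : R) :
  is_derive y 1 (fun y : R => y ^+ k.+1 / k.+1`!%:R) (y ^+ k / k`!%:R).
Proof.
have dX : is_derive y 1 (fun y : R => y ^+ k.+1) (k.+1%:R * y ^+ k).
  have := is_deriveX k.+1 (is_derive_id y 1).
  have -> : (id : R -> R) ^+ k.+1 = (fun y : R => y ^+ k.+1).
    by apply/funext => z; rewrite exprfctE.
  by move=> h1; apply: (is_derive_eq h1); rewrite /GRing.scale/= mulr1.
have := is_deriveZ (k.+1`!%:R^-1) dX.
have -> : k.+1`!%:R^-1 \*: (fun y : R => y ^+ k.+1) =
    (fun y : R => y ^+ k.+1 / k.+1`!%:R).
  by apply/funext => z; rewrite /GRing.scale/= mulrC.
move=> h1; apply: (is_derive_eq h1); rewrite /GRing.scale/= factS natrM.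
by rewrite invfM mulrACA mulVf ?pnatr_eq0// mul1r mulrC.
Qed.

(** The difference [y ^+ k.+1 / k.+1! - f y] vanishes at zero and has nonnegative derivative on
    [[0, x]], so the mean value theorem applies to it. *)
Lemma derive_le_exprn_ge0 (f f' : R -> R) k :
  (forall x : R, is_derive x 1 f (f' x)) -> f 0 = 0 ->
  (forall x, `|f' x| <= `|x| ^+ k / k`!%:R) ->
  forall x, 0 <= x -> f x <= x ^+ k.+1 / k.+1`!%:R.
Proof.
move=> df f0 bf x; rewrite le_eqVlt => /predU1P[<-|x0].
  by rewrite f0 exprS !mul0r.
pose h (y : R) : R := y ^+ k.+1 / k.+1`!%:R - f y.
have dh (y : R) : is_derive y 1 h (y ^+ k / k`!%:R - f' y).
  exact: is_deriveB (is_derive_exprn_fact k y) (df y).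
have [|c] := @MVT R h (fun y => y ^+ k / k`!%:R - f' y) 0 x x0 (fun y _ => dh y).
  apply: continuous_subspaceT => y.
  by apply/differentiable_continuous/derivable1_diffP; have := dh y.
rewrite in_itv/= => /andP[c0 cx] hE.
have h0 : h 0 = 0 by rewrite /h f0 exprS !mul0r subr0.
rewrite -subr_ge0; suff : 0 <= h x by [].
have -> : h x = h x - h 0 by rewrite h0 subr0.
rewrite hE mulr_ge0//; last by rewrite subr_ge0 ltW.
rewrite subr_ge0; apply: le_trans (ler_norm _) _.
by rewrite (le_trans (bf c))// [`|c|]ger0_norm// ltW.
Qed.

Lemma derive_le_exprn (f f' : R -> R) k :
  (forall x : R, is_derive x 1 f (f' x)) -> f 0 = 0 ->
  (forall x, `|f' x| <= `|x| ^+ k / k`!%:R) ->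
  forall x, `|f x| <= `|x| ^+ k.+1 / k.+1`!%:R.
Proof.
have pos (g g' : R -> R) : (forall x : R, is_derive x 1 g (g' x)) -> g 0 = 0 ->
    (forall x, `|g' x| <= `|x| ^+ k / k`!%:R) ->
    forall x, 0 <= x -> `|g x| <= x ^+ k.+1 / k.+1`!%:R.
  move=> dg g0 bg x x0; rewrite ler_norml; apply/andP; split; last first.
    exact: derive_le_exprn_ge0 dg g0 bg _ x0.
  rewrite lerNl; apply: (@derive_le_exprn_ge0 (fun x => - g x) (fun x => - g' x) k
    (fun y => is_deriveN (dg y))) => //.
  - by rewrite g0 oppr0.
  - by move=> y; rewrite normrN.
move=> df f0 bf x; have [x0|x0] := leP 0 x.
  by rewrite [`|x|]ger0_norm//; exact: pos df f0 bf _ x0.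
have dfN (y : R) : is_derive y 1 (fun y => f (- y)) (- f' (- y)).
  have dN : is_derive (y : R) 1 (fun y : R => - y) (-1).
    exact: is_deriveN (is_derive_id y 1).
  have := @is_derive1_comp _ f (fun y : R => - y) y _ _ (df (- y)) dN.
  by rewrite mulrN1.
have h : `|f (- - x)| <= (- x) ^+ k.+1 / k.+1`!%:R.
  apply: (pos (fun y => f (- y)) (fun y => - f' (- y))) => //.
  - by rewrite oppr0.
  - by move=> y; rewrite normrN (le_trans (bf _))// normrN.
  - by rewrite oppr_ge0 ltW.
by move: h; rewrite opprK -[`|x|]normrN [`|- x|]ger0_norm// oppr_ge0 ltW.
Qed.

(* The [k]-th derivative of [cos (x + t)] at [x = 0] is [cos (t + k pi / 2)]. *)
Definition cos_taylor (n : nat) (t x : R) : R :=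
  \sum_(k < n) cos (t + k%:R * (pi / 2)) * x ^+ k / k`!%:R.

Lemma cos_taylorS n (t x : R) : cos_taylor n.+1 t x =
  cos_taylor n t x + cos (t + n%:R * (pi / 2)) * x ^+ n / n`!%:R.
Proof. by rewrite /cos_taylor big_ord_recr. Qed.

Lemma is_derive_cos_taylor n (t x : R) :
  is_derive x 1 (cos_taylor n.+1 t) (cos_taylor n (t + pi / 2) x).
Proof.
elim: n => [|n IHn].
  have -> : cos_taylor 1 t = cst (cos t).
    apply/funext => y.
    by rewrite cos_taylorS /cos_taylor big_ord0 add0r mul0r addr0 mulr1 divr1.
  by rewrite /cos_taylor big_ord0; exact: is_derive_cst.
have -> : cos_taylor n.+2 t = (cos_taylor n.+1 t +
    (fun y => cos (t + n.+1%:R * (pi / 2)) * (y ^+ n.+1 / n.+1`!%:R))).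
  by apply/funext => y; rewrite cos_taylorS -mulrA.
rewrite cos_taylorS; apply: is_deriveD.
have := is_deriveZ (cos (t + n.+1%:R * (pi / 2))) (is_derive_exprn_fact n x).
move=> h1; apply: (is_derive_eq h1); rewrite /GRing.scale/= -[RHS]mulrA.
by congr (cos _ * _); rewrite -natr1 mulrDl mul1r addrA addrAC.
Qed.

Lemma cos_taylor0 n (t : R) : cos_taylor n.+1 t 0 = cos t.
Proof.
rewrite /cos_taylor big_ord_recl big1 ?addr0 => [|i _].
  by rewrite mul0r addr0 mulr1 divr1.
by rewrite exprS mul0r mulr0 mul0r.
Qed.

(** Differentiation adds [pi / 2] to the phase and removes one term: the remainder of order [n.+1]
    at phase [t] has as derivative the remainder of order [n] at phase [t + pi / 2]. This is why the
    induction runs over all phases. *)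
Lemma cos_taylor_le n (t x : R) :
  `|cos (x + t) - cos_taylor n t x| <= `|x| ^+ n / n`!%:R.
Proof.
elim: n t x => [|n IHn] t x.
  by rewrite /cos_taylor big_ord0 subr0 divr1 cos_max.
have dR (y : R) : is_derive y 1 (fun x => cos (x + t) - cos_taylor n.+1 t x)
    (cos (y + (t + pi / 2)) - cos_taylor n (t + pi / 2) y).
  apply: is_deriveB; last exact: is_derive_cos_taylor.
  have dt : is_derive y 1 (fun y => y + t) 1.
    by apply: is_derive_eq; rewrite addr0.
  have := @is_derive1_comp _ cos (fun y => y + t) y _ _ (is_derive_cos _) dt.
  by rewrite mulr1 addrA cosDpihalf.
apply: (derive_le_exprn dR) => //.
by rewrite add0r cos_taylor0 subrr.
Qed.
End taylor.

Section char.
Context d (T : measurableType d) (R : realType) (P : probability T R).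
Variable Y : T -> R.
Hypothesis gY : gaussian_moments P Y.
Local Notation v := (\int[P]_w (Y w ^+ 2)).

Let mY : measurable_fun setT Y. Proof. by case: gY. Qed.
Let iY k : P.-integrable setT (EFin \o (fun w => Y w ^+ k)).
Proof. by case: gY. Qed.
Let Y1 : \int[P]_w Y w = 0. Proof. by case: gY. Qed.
Let YS k : \int[P]_w (Y w ^+ k.+2) = k.+1%:R * v * \int[P]_w (Y w ^+ k).
Proof. by case: gY => _ _ _ /(_ k). Qed.

Lemma odd_moment_gaussian j : \int[P]_w (Y w ^+ j.*2.+1) = 0.
Proof.
elim: j => [|j IHj]; last by rewrite YS IHj mulr0.
by under eq_Rintegral do rewrite expr1; exact: Y1.
Qed.

(** The quotients are the terms of the exponential series of [v / 2], which serves twice: with signs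
    they sum to the characteristic function, and without signs they bound the Taylor error. *)
Lemma even_moment_gaussian j :
  \int[P]_w (Y w ^+ j.*2) / j.*2`!%:R = (v / 2) ^+ j / j`!%:R.
Proof.
elim: j => [|j IHj].
  under eq_Rintegral do rewrite expr0.
  by rewrite Rintegral_cst//= mul1r probability_setT expr0.
have c0 : (j.+1%:R : R) != 0 by rewrite pnatr_eq0.
have b0 : (j.*2.+1%:R : R) != 0 by rewrite pnatr_eq0.
have f0 k : (k`!%:R : R) != 0 by rewrite pnatr_eq0 -lt0n fact_gt0.
have e1 : (j.*2.+2`!%:R : R) = 2 * j.+1%:R * (j.*2.+1%:R * j.*2`!%:R).
  by rewrite !factS !natrM -doubleS -mul2n natrM.
have e2 : (j.+1`!%:R : R) = j.+1%:R * j`!%:R by rewrite factS natrM.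
rewrite doubleS YS e1 e2 exprS.
move: (f0 j) (f0 j.*2) c0 b0 IHj.
move: (\int[P]_w (Y w ^+ j.*2)) (j`!%:R : R) (j.*2`!%:R : R) (j.+1%:R : R)
  (j.*2.+1%:R : R) => M x y c b x0 y0 c0 b0 IHj.
have {IHj} -> : M = (v / 2) ^+ j / x * y by rewrite -IHj divfK.
by field; rewrite c0 b0 x0 y0.
Qed.

Lemma integrable_cos_taylor n t :
  P.-integrable setT (EFin \o (fun w => cos_taylor n t (Y w))).
Proof.
elim: n => [|n IHn].
  rewrite /cos_taylor; under [X in EFin \o X]eq_fun do rewrite big_ord0.
  exact: finite_measure_integrable_cst.
have h := integrableZl measurableT (cos (t + n%:R * (pi / 2)) / n`!%:R) (iY n).
apply: eq_integrable (integrableD measurableT IHn h) => // w _ /=.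
by rewrite cos_taylorS mulrAC.
Qed.

Lemma Rintegral_cos_taylor n t :
  \int[P]_w (cos_taylor n t (Y w)) =
  \sum_(k < n) cos (t + k%:R * (pi / 2)) * (\int[P]_w (Y w ^+ k) / k`!%:R).
Proof.
elim: n => [|n IHn].
  rewrite big_ord0; under eq_Rintegral do rewrite /cos_taylor big_ord0.
  by rewrite Rintegral_cst//= mul0r.
have h := integrableZl measurableT (cos (t + n%:R * (pi / 2)) / n`!%:R) (iY n).
have h' : P.-integrable setT
    (EFin \o (fun w => (cos (t + n%:R * (pi / 2)) / n`!%:R) * Y w ^+ n)) by [].
transitivity (\int[P]_w (cos_taylor n t (Y w) + (cos (t + n%:R * (pi / 2)) / n`!%:R) * Y w ^+ n)).
  by apply: eq_Rintegral => w _; rewrite cos_taylorS mulrAC.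
rewrite RintegralD//; last exact: integrable_cos_taylor.
by rewrite IHn big_ord_recr/= RintegralZl// -mulrA [_^-1 * _]mulrC.
Qed.

(** Odd moments vanish; in degree [j.*2] the phase is [t + j pi], which contributes the sign
    [(-1) ^+ j]. *)
Lemma Rintegral_cos_taylor_double n t :
  \int[P]_w (cos_taylor n.*2 t (Y w)) =
  cos t * series (exp_coeff (- (v / 2))) n.
Proof.
rewrite Rintegral_cos_taylor.
have cosj j : cos (t + j.*2%:R * (pi / 2)) = (-1) ^+ j * cos t.
  have -> : j.*2%:R * (pi / 2) = pi *+ j :> R.
    by rewrite -mul2n natrM -mulr_natr; field.
  exact: (alternatingn (@cosDpi R)).
elim: n => [|n IHn]; first by rewrite /series/= big_ord0 big_geq// mulr0.
rewrite doubleS 2!big_ord_recr/= IHn odd_moment_gaussian mul0r mulr0 addr0.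
rewrite cosj even_moment_gaussian seriesS mulrDr addrC; congr (_ + _).
by rewrite /exp_coeff/= (exprNn (v / 2)); ring.
Qed.

Lemma integrable_cos_gaussian t :
  P.-integrable setT (EFin \o (fun w => cos (Y w + t))).
Proof.
apply: (le_integrable measurableT _ _
  (finite_measure_integrable_cst P (1 : R) measurableT)).
  apply/measurable_EFinP/measurableT_comp; last exact: measurable_funD.
  by apply: continuous_measurable_fun; exact: continuous_cos.
by move=> w _ /=; rewrite lee_fin normr1 cos_max.
Qed.

(** The error of the Taylor polynomial of order [n.*2] integrates to at most [E[Y^(2n)] / (2n)!], a
    term of a convergent series. Both the expectation of the cosine and the exponential are
    therefore limits of the same sequence, without exchanging an infinite sum and an integral. *)
Lemma Rintegral_cos_gaussian t :
  \int[P]_w cos (Y w + t) = cos t * expR (- (v / 2)).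
Proof.
pose s n := \int[P]_w (cos_taylor n.*2 t (Y w)).
have bound n : `|s n - \int[P]_w cos (Y w + t)| <= exp_coeff (v / 2) n.
  rewrite distrC -RintegralB//; last 2 first.
    exact: integrable_cos_gaussian.
    exact: integrable_cos_taylor.
  have iB := integrableB measurableT (integrable_cos_gaussian t)
    (integrable_cos_taylor n.*2 t).
  apply: (le_trans (le_normr_Rintegral measurableT iB)).
  rewrite /exp_coeff/= -even_moment_gaussian -RintegralZr//.
  apply: le_Rintegral => //.
  - exact: (integrable_norm iB).
  - exact: (integrableZr measurableT _ (iY n.*2)).
  - move=> w _; rewrite (le_trans (cos_taylor_le _ _ _))//.
    by rewrite -normrX ger0_norm// -mul2n mulnC exprM sqr_ge0.
have l1 : s n @[n --> \oo] --> \int[P]_w cos (Y w + t).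
  apply/cvgrPdist_le => e e0.
  have := @cvg_exp_coeff R (v / 2).
  move/cvgrPdist_le => /(_ e e0); apply: filterS => n.
  rewrite sub0r normrN => h; rewrite distrC (le_trans (bound n))//.
  exact: le_trans (ler_norm _) h.
have l2 : s n @[n --> \oo] --> cos t * expR (- (v / 2)).
  rewrite (_ : s = fun n => cos t * series (exp_coeff (- (v / 2))) n).
    apply: cvgM; first exact: cvg_cst.
    exact: is_cvg_series_exp_coeff.
  by apply/funext => n; rewrite /s Rintegral_cos_taylor_double.
exact: cvg_unique l1 l2.
Qed.
End char.

(** * Closure under dominated limits *)

Section closure.
Context {R : realType}.

(** As an inductive predicate it transfers by induction any identity that its three clauses
    preserve. The common polynomial bound in [Closure_lim] is what dominated convergence needs for
    variables having all moments; with constant bounds only, bounded generators would never lead to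
    monomials. *)
Inductive dominated_closure (G : set (R -> R)) : (R -> R) -> Prop :=
| Closure_gen f : G f -> dominated_closure G f
| Closure_lin c f g : dominated_closure G f -> dominated_closure G g ->
    dominated_closure G (fun x => c * f x + g x)
| Closure_lim (f_ : nat -> R -> R) f C k :
    (forall n, dominated_closure G (f_ n)) ->
    (forall n x, `|f_ n x| <= C * (1 + x ^+ 2) ^+ k) ->
    (forall x, f_ n x @[n --> \oo] --> f x) ->
    dominated_closure G f.

(** The base [1 + x ^+ 2] is at least one, so exponents can be enlarged when two bounds are
    combined. *)
Definition poly_dominated (f : R -> R) := measurable_fun setT f /\
  exists C k, forall x, `|f x| <= C * (1 + x ^+ 2) ^+ k.

Lemma sqrDr1_ge1 (x : R) k : 1 <= (1 + x ^+ 2) ^+ k.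
Proof. by rewrite exprn_ege1// lerDl sqr_ge0. Qed.

Lemma dominated_closure_poly_dominated (G : set (R -> R)) :
  G `<=` poly_dominated -> dominated_closure G `<=` poly_dominated.
Proof.
move=> GP f; elim => {f}.
- by move=> f /GP.
- move=> c f g _ [mf [C [k Hf]]] _ [mg [D [l Hg]]]; split.
    by apply: measurable_funD => //; exact: measurable_funM.
  exists (`|c| * C + D), (k + l)%N => x.
  have C0 : 0 <= C.
    by have := Hf 0; rewrite expr0n addr0 expr1n mulr1; exact: le_trans.
  have D0 : 0 <= D.
    by have := Hg 0; rewrite expr0n addr0 expr1n mulr1; exact: le_trans.
  apply: (le_trans (ler_normD _ _)); rewrite mulrDl lerD//.
    rewrite normrM -mulrA ler_wpM2l// (le_trans (Hf x))// ler_wpM2l//.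
    by rewrite exprD ler_peMr ?sqrDr1_ge1// (le_trans ler01)// sqrDr1_ge1.
  rewrite (le_trans (Hg x))// ler_wpM2l//.
  by rewrite exprD ler_peMl ?sqrDr1_ge1// (le_trans ler01)// sqrDr1_ge1.
- move=> f_ f C k _ IH bd lim; split.
    apply: (@measurable_fun_cvg _ _ _ setT f_) => //.
    by move=> n; case: (IH n).
  exists C, k => x; apply: (cvgr_to_le (cvg_norm (lim x))).
  exact: nearW.
Qed.

Section lemmas.
Variable G : set (R -> R).
Hypothesis GP : G `<=` poly_dominated.
Hypothesis GM : forall f g, G f -> G g -> dominated_closure G (f \* g).
Hypothesis G1 : G (cst 1).

Let closureP := dominated_closure_poly_dominated GP.

Lemma closure_cst c : dominated_closure G (cst c).
Proof.
have h1 := Closure_gen G1.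
have h0 := Closure_lin (-1) h1 h1.
have := Closure_lin c h1 h0.
by congr dominated_closure; apply/funext => x /=; ring.
Qed.

Lemma closureZ c f : dominated_closure G f ->
  dominated_closure G (fun x => c * f x).
Proof.
move=> hf; have := Closure_lin c hf (closure_cst 0).
by congr dominated_closure; apply/funext => x /=; rewrite addr0.
Qed.

(** Induction on [f] and, when [f] is a generator, on [g]. In the limit clause the fixed factor is
    itself polynomially dominated, and the two bounds multiply. *)
Lemma closureM f g : dominated_closure G f -> dominated_closure G g ->
  dominated_closure G (f \* g).
Proof.
have limM (f_ : nat -> R -> R) (u h : R -> R) C k :
    (forall n x, `|f_ n x| <= C * (1 + x ^+ 2) ^+ k) ->
    (forall x, f_ n x @[n --> \oo] --> u x) ->
    dominated_closure G h ->
    (forall n, dominated_closure G (f_ n \* h)) ->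
    dominated_closure G (u \* h).
  move=> bd lim hh H; have [_ [D [l Hh]]] := closureP hh.
  apply: (@Closure_lim _ (fun n => f_ n \* h) _ (C * D) (k + l)) => // [n x|x].
    by rewrite /= normrM exprD mulrACA ler_pM.
  by apply: cvgM => //; exact: cvg_cst.
have mulC (u h : R -> R) : u \* h = h \* u.
  by apply/funext => x /=; rewrite mulrC.
move=> hf hg; elim: hf => {f}.
- move=> f Gf; elim: hg => {g}.
  + by move=> g Gg; exact: GM.
  + move=> c g h _ Hg _ Hh; have := Closure_lin c Hg Hh.
    by congr dominated_closure; apply/funext => x /=; ring.
  + move=> g_ g C k hg IH bd lim; rewrite mulC.
    apply: limM bd lim (Closure_gen Gf) _ => n; rewrite mulC; exact: IH.
- move=> c f h _ Hf _ Hh; have := Closure_lin c Hf Hh.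
  by congr dominated_closure; apply/funext => x /=; ring.
- by move=> f_ f C k _ IH bd lim; exact: limM bd lim hg IH.
Qed.

Lemma closureX f n : dominated_closure G f ->
  dominated_closure G (fun x => f x ^+ n).
Proof.
move=> hf; elim: n => [|n IHn].
  have := closure_cst 1.
  by congr dominated_closure; apply/funext => x /=; rewrite expr0.
have := closureM hf IHn.
by congr dominated_closure; apply/funext => x /=; rewrite exprS.
Qed.

Lemma closure_lim_bounded (f_ : nat -> R -> R) f M :
  (forall n, dominated_closure G (f_ n)) ->
  (forall n x, `|f_ n x| <= M) ->
  (forall x, f_ n x @[n --> \oo] --> f x) ->
  dominated_closure G f.
Proof.
move=> hf bd; apply: (@Closure_lim _ _ _ M 0) => // n x.
by rewrite expr0 mulr1.
Qed.

(** The closure is an algebra stable under bounded pointwise limits, so the sets whose indicator it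
    contains form a sigma-algebra. The open rays generate the Borel sets. *)
Lemma closure_indic (A : set R) :
  (forall c : R, dominated_closure G (\1_`]c, +oo[)) ->
  measurable A -> dominated_closure G (\1_A).
Proof.
move=> hray.
have : @measurable _ (measurableTypeR R) `<=` [set A : set R | dominated_closure G (\1_A)].
  rewrite RGenOInfty.measurableE.
  apply: smallest_sub; last by move=> _ [c ->]; exact: hray.
  split => /=.
  - by have := closure_cst 0; rewrite indic0.
  - move=> B hB; have := Closure_lin (-1) hB (closure_cst 1).
    congr dominated_closure; apply/funext => x /=.
    by rewrite setTD !indicE in_setC; case: (x \in B) => /=; ring.
  - move=> F hF.
    (* The indicator of the union of the first [n] sets, written with products and complements so
       that closure under products applies. *)
    pose f n := fun x => 1 - \prod_(i < n) (1 - \1_(F i) x) : R.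
    have prodE n x : \prod_(i < n) (1 - \1_(F i) x) =
        \1_(~` \big[setU/set0]_(i < n) F i) x :> R.
      elim: n => [|n IHn]; first by rewrite !big_ord0 setC0 indicT.
      rewrite !big_ord_recr/= IHn setCU !indicE in_setI !in_setC.
      by case: (_ \in _); case: (_ \in _) => /=; ring.
    have fE n x : f n x = \1_(\big[setU/set0]_(i < n) F i) x.
      by rewrite /f prodE !indicE in_setC; case: (_ \in _) => /=; ring.
    apply: (@closure_lim_bounded f _ 1).
    + move=> n; rewrite /f.
      have hp : dominated_closure G (fun x => \prod_(i < n) (1 - \1_(F i) x)).
        elim: n => [|n IHn].
          have := closure_cst 1.
          by congr dominated_closure; apply/funext => x /=; rewrite big_ord0.
        have := closureM IHn (Closure_lin (-1) (hF n) (closure_cst 1)).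
        congr dominated_closure; apply/funext => x /=.
        by rewrite big_ord_recr/=; ring.
      have := Closure_lin (-1) hp (closure_cst 1).
      by congr dominated_closure; apply/funext => x /=; ring.
    + by move=> n x; rewrite fE indicE; case: (_ \in _); rewrite ?normr1 ?normr0.
    + move=> x; apply: cvg_near_cst.
      have [[i _ Fix]|nF] := pselect ((\bigcup_k F k) x).
        exists i.+1 => // n /= ni; rewrite fE !indicE !mem_set//; first by exists i.
        rewrite -bigcup_mkord; exists i => //.
      apply: nearW => n; rewrite fE !indicE !memNset//.
      by rewrite -bigcup_mkord => -[i _ Fi]; apply: nF; exists i.
by apply.
Qed.
End lemmas.
End closure.

(** * Monomials and indicators as limits of combinations of cosines *)

Section cosines.
Context {R : realType}.

Definition cosines : set (R -> R) :=
  [set f | exists t a, f = (fun x => cos (t * x + a))].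

Local Notation closure := (dominated_closure cosines).

Lemma cosines_poly_dominated : cosines `<=` poly_dominated.
Proof.
move=> _ [t [a ->]]; split.
  apply: measurableT_comp.
    by apply: continuous_measurable_fun; exact: continuous_cos.
  by apply: measurable_funD => //; exact: measurable_funM.
by exists 1, 0%N => x; rewrite expr0 mulr1 cos_max.
Qed.

Lemma cosines1 : cosines (cst 1).
Proof. by exists 0, 0; apply/funext => x; rewrite mul0r addr0 cos0. Qed.

Lemma cosinesM (f g : R -> R) : cosines f -> cosines g -> closure (f \* g).
Proof.
move=> [t [a ->]] [s [b ->]].
have c1 : closure (fun x => cos ((t + s) * x + (a + b))).
  by apply: Closure_gen; exists (t + s), (a + b).
have c2 : closure (fun x => cos ((t - s) * x + (a - b))).
  by apply: Closure_gen; exists (t - s), (a - b).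
have c0 : closure (fun x => 0).
  have h := Closure_gen cosines1; have := Closure_lin (-1) h h.
  by congr dominated_closure; apply/funext => x /=; ring.
have := Closure_lin 2^-1 c1 (Closure_lin 2^-1 c2 c0).
congr dominated_closure; apply/funext => x /=.
have -> : (t + s) * x + (a + b) = (t * x + a) + (s * x + b) by ring.
have -> : (t - s) * x + (a - b) = (t * x + a) - (s * x + b) by ring.
by rewrite cosD cosB; field.
Qed.

Let GP := cosines_poly_dominated.
Let GM := cosinesM.
Let G1 := cosines1.

Lemma closure_sin t a : closure (fun x => sin (t * x + a)).
Proof.
apply: Closure_gen; exists t, (a - pi / 2); apply/funext => x.
by rewrite addrA cosBpihalf.
Qed.

(** At phase [- (pi / 2)] the cosine is a sine, so the Taylor bounds of orders one and two become
    this estimate and the next. *)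
Lemma normr_sin_le (x : R) : `|sin x| <= `|x|.
Proof.
have := cos_taylor_le 1 (- (pi / 2)) x.
rewrite cosBpihalf /cos_taylor big_ord_recr big_ord0/= mul0r addr0 cosN.
by rewrite cos_pihalf !mul0r addr0 subr0 expr1 divr1.
Qed.

Lemma sin_sub_le (x : R) : `|sin x - x| <= x ^+ 2 / 2.
Proof.
have := cos_taylor_le 2 (- (pi / 2)) x.
rewrite cosBpihalf /cos_taylor !big_ord_recr big_ord0/= mul0r addr0 cosN.
rewrite cos_pihalf !mul0r !add0r mul1r addNr cos0 mul1r expr1 divr1.
by rewrite real_normK ?num_real.
Qed.

(** The functions [n sin (x / n)] converge to [x] and are dominated by [|x| <= 1 + x ^+ 2]. *)
Lemma closure_id : closure id.
Proof.
pose f n (x : R) : R := n.+1%:R * sin (n.+1%:R^-1 * x + 0).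
have n0 n : (n.+1%:R : R) != 0 by rewrite pnatr_eq0.
apply: (@Closure_lim _ _ f _ 1 1).
- by move=> n; apply: (closureZ G1); exact: closure_sin.
- move=> n x; rewrite /f addr0 normrM mul1r expr1.
  apply: (@le_trans _ _ `|x|); last first.
    by rewrite -[x ^+ 2]real_normK ?num_real//; have := normr_ge0 x; nra.
  rewrite (le_trans (ler_wpM2l (normr_ge0 _) (normr_sin_le _)))//.
  by rewrite -normrM mulVKf.
- move=> x; apply/cvgrPdist_le => e e0.
  near=> n.
  have fx : `|f n x - x| <= x ^+ 2 / 2 / n.+1%:R.
    have -> : f n x - x = n.+1%:R * (sin (n.+1%:R^-1 * x) - n.+1%:R^-1 * x).
      by rewrite /f addr0 mulrBr mulVKf.
    rewrite normrM [`|n.+1%:R|]ger0_norm//.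
    rewrite (le_trans (ler_wpM2l _ (sin_sub_le _)))//.
    have -> // : n.+1%:R * ((n.+1%:R^-1 * x) ^+ 2 / 2) = x ^+ 2 / 2 / n.+1%:R.
    by move: (n.+1%:R : R) (n0 n) => N N0; field.
  rewrite distrC (le_trans fx)// ler_pdivrMr// -ler_pdivrMl//.
  rewrite (@le_trans _ _ n%:R) ?ler_nat//.
  by near: n; exact: nbhs_infty_ger.
Unshelve. all: by end_near. Qed.

(* Newton's iteration for the sign of a number of [[-1, 1]]. *)
Definition sign_step (s : R) : R := 3 / 2 * s - s ^+ 3 / 2.

Lemma sign_step_iter_norm n (s : R) : `|s| <= 1 -> `|iter n sign_step s| <= 1.
Proof.
move=> s1; elim: n => //= n; set u := iter n _ s; rewrite /sign_step.
rewrite !ler_norml => /andP[u1 u2]; apply/andP; split.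
  (* This product is twice [1 + sign_step u]; the product used below is twice [1 - sign_step u]. *)
  have : 0 <= (u + 1) ^+ 2 * (2 - u) by rewrite mulr_ge0 ?sqr_ge0//; lra.
  by lra.
have : 0 <= (1 - u) ^+ 2 * (2 + u) by rewrite mulr_ge0 ?sqr_ge0//; lra.
by lra.
Qed.

(** The iterates increase and stay at least [s], so each step multiplies the distance to 1 by at
    most [q = 1 - s / 2]. *)
Lemma sign_step_iter_cvg1 (s : R) : 0 < s <= 1 ->
  iter n sign_step s @[n --> \oo] --> (1 : R).
Proof.
move=> /andP[s0 s1]; pose q := 1 - s / 2.
have H n : s <= iter n sign_step s <= 1 /\ 1 - iter n sign_step s <= q ^+ n.
  elim: n => [|n []]; first by rewrite /= lexx s1 expr0; split => //; lra.
  rewrite [iter n.+1 _ _]iterS; set u := iter n _ s => /andP[su u1] uq.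
  have e1 : 1 - sign_step u = (1 - u) * (1 - u / 2 - u ^+ 2 / 2).
    by rewrite /sign_step; field.
  have q0 : 0 <= q by rewrite /q; lra.
  split; [apply/andP; split|].
  - have : 0 <= u * (1 - u) * (1 + u) by rewrite !mulr_ge0//; lra.
    by rewrite /sign_step; lra.
  - rewrite -subr_ge0 e1; apply: mulr_ge0; first lra.
    have : 0 <= (1 - u) * (2 + u) by apply: mulr_ge0; lra.
    by lra.
  - rewrite e1 (exprS q) [leLHS]mulrC; apply: ler_pM; first last.
    + exact: uq.
    + by rewrite /q; have := sqr_ge0 u; lra.
    + by lra.
    + have : 0 <= (1 - u) * (2 + u) by apply: mulr_ge0; lra.
      by lra.
apply/cvgrPdist_le => e e0.
have : q ^+ n @[n --> \oo] --> (0 : R).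
  by apply: cvg_expr; rewrite ger0_norm /q; lra.
move/cvgrPdist_le => /(_ e e0); apply: filterS => n.
rewrite sub0r normrN; apply: le_trans.
have [/andP[_ h1] h2] := H n.
by rewrite ger0_norm ?subr_ge0// (le_trans h2)// ler_norm.
Qed.

Lemma sign_step_iterN n (s : R) : iter n sign_step (- s) = - iter n sign_step s.
Proof. by elim: n => //= n ->; rewrite /sign_step; field. Qed.

Lemma sign_step_iter_cvg (s : R) : `|s| <= 1 ->
  iter n sign_step s @[n --> \oo] --> Num.sg s.
Proof.
rewrite ler_norml => /andP[s1 s2]; have [s0|s0|->] := ltrgt0P s.
- by rewrite gtr0_sg//; apply: sign_step_iter_cvg1; rewrite s0.
- rewrite ltr0_sg//.
  rewrite (_ : (fun n => _) = (fun n => - iter n sign_step (- s))).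
    by apply: cvgN; apply: sign_step_iter_cvg1; rewrite oppr_gt0 s0; lra.
  by apply/funext => n; rewrite sign_step_iterN opprK.
- rewrite sgr0; apply: cvg_near_cst; apply: nearW => n.
  by elim: n => //= n ->; rewrite /sign_step; lra.
Qed.

(** Each iterate of [sign_step] is a polynomial in the sine, hence belongs to the closure, and all
    iterates are bounded by 1. *)
Lemma closure_sg_sin t a : closure (fun x => Num.sg (sin (t * x + a))).
Proof.
have sin1 (x : R) : `|sin x| <= 1 by rewrite -cosBpihalf cos_max.
apply: (@closure_lim_bounded _ _ (fun n x => iter n sign_step (sin (t * x + a))) _ 1).
- elim=> [|n IHn]; first exact: closure_sin.
  have := Closure_lin (3 / 2) IHn (closureZ G1 (- 2^-1) (closureX GP GM G1 3 IHn)).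
  congr dominated_closure; apply/funext => x /=.
  by rewrite /sign_step; ring.
- by move=> n x; exact: sign_step_iter_norm.
- by move=> x; exact: sign_step_iter_cvg.
Qed.

(** The square wave is stretched around [c]: as soon as [|x - c| / n.+1 < pi / 2], the sine of
    [(x - c) / n.+1] has the sign of [x - c]. *)
Lemma closure_sg c : closure (fun x => Num.sg (x - c)).
Proof.
pose f n (x : R) : R := Num.sg (sin (n.+1%:R^-1 * x + - (n.+1%:R^-1 * c))).
apply: (@closure_lim_bounded _ _ f _ 1).
- by move=> n; exact: closure_sg_sin.
- by move=> n x; rewrite normr_sg; case: (_ != 0).
- move=> x; apply: cvg_near_cst; near=> n.
  rewrite /f -mulrBr; set y := x - c.
  have yn : `|y| < n.+1%:R * (pi / 2).
    apply: (@lt_le_trans _ _ (n.+1%:R * 1)); last first.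
      by rewrite ler_wpM2l//; exact: pihalf_ge1.
    rewrite mulr1 (@le_lt_trans _ _ n%:R) ?ltr_nat//.
    by near: n; exact: nbhs_infty_ger.
  have pos z : 0 < z -> z < n.+1%:R * (pi / 2) -> 0 < sin (n.+1%:R^-1 * z).
    move=> z0 zn; apply: sin_gt0_pihalf; rewrite mulr_gt0//= ?invr_gt0//.
    by rewrite ltr_pdivrMl.
  have [y0|y0|->] := ltrgt0P y.
  + rewrite (gtr0_sg y0) gtr0_sg// pos//; exact: le_lt_trans (ler_norm _) yn.
  + rewrite (ltr0_sg y0) -[y]opprK mulrN sinN ltr0_sg// oppr_lt0 pos ?oppr_gt0//.
    by rewrite (le_lt_trans _ yn)// -normrN ler_norm.
  + by rewrite mulr0 sin0.
Unshelve. all: by end_near. Qed.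

Lemma closure_cosines_indic (A : set R) : measurable A -> closure (\1_A).
Proof.
apply: (closure_indic GP GM G1) => c.
have hs := closure_sg c.
(* The half sum of [sg ^+ 2] and [sg] is the indicator of the open ray; it vanishes at [x = c]. *)
have := Closure_lin 2^-1 (closureX GP GM G1 2 hs) (closureZ G1 2^-1 hs).
congr dominated_closure; apply/funext => x /=.
rewrite indicE mem_setE in_itv/= andbT -subr_gt0.
by case: (ltrgt0P (x - c)) => h;
  rewrite ?(gtr0_sg h) ?(ltr0_sg h) ?h ?sgr0 /=; field.
Qed.

Lemma closure_cosines_exprn k : closure (fun x => x ^+ k).
Proof. exact: (closureX GP GM G1 k closure_id). Qed.
End cosines.

(** * Extension of factorised expectations to the closure *)

Lemma measurable_sqrDr1 d (T : measurableType d) (R : realType) (Y : T -> R) k :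
  measurable_fun setT Y ->
  measurable_fun setT (fun w => (1 + Y w ^+ 2) ^+ k).
Proof.
by move=> mY; apply: measurable_funX; apply: measurable_funD => //; apply: measurable_funX.
Qed.

Section factor.
Context d (T : measurableType d) (R : realType) (P : probability T R).

Definition all_moments (Y : T -> R) := measurable_fun setT Y /\
  forall k, P.-integrable setT (EFin \o (fun w => Y w ^+ k)).

Lemma sqrDr1_le (x : R) k : (1 + x ^+ 2) ^+ k <= 2 ^+ k * (1 + (x ^+ 2) ^+ k).
Proof.
have x0 := sqr_ge0 x; have [x1|x1] := leP (x ^+ 2) 1.
  apply: (@le_trans _ _ (2 ^+ k)).
    by apply: lerXn2r; rewrite ?nnegrE; lra.
  by rewrite ler_peMr ?exprn_ge0// lerDl exprn_ge0 ?sqr_ge0.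
apply: (@le_trans _ _ ((2 * x ^+ 2) ^+ k)).
  by apply: lerXn2r; rewrite ?nnegrE; lra.
by rewrite exprMn ler_wpM2l ?exprn_ge0// lerDr.
Qed.

Lemma integrable_sqrDr1 (Y : T -> R) k : all_moments Y ->
  P.-integrable setT (EFin \o (fun w => (1 + Y w ^+ 2) ^+ k)).
Proof.
move=> [mY iY].
have h : P.-integrable setT (EFin \o (fun w => 2 ^+ k * (1 + Y w ^+ (2 * k)))).
  have i1 := integrableD measurableT (iY 0%N) (iY (2 * k)%N).
  apply: eq_integrable (integrableZl measurableT (2 ^+ k) i1) => // w _ /=.
apply: le_integrable h => //.
  exact/measurable_EFinP/measurable_sqrDr1.
move=> w _ /=; rewrite lee_fin ger0_norm; last first.
  by rewrite (le_trans ler01)// sqrDr1_ge1.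
by rewrite exprM (le_trans (sqrDr1_le _ _))// ler_norm.
Qed.

(** The product is at most the cube of the largest factor. In place of Hölder's inequality, it makes
    products of three variables integrable from their separate moments. *)
Lemma mul3_le (a b c : R) : 0 <= a -> 0 <= b -> 0 <= c ->
  a * b * c <= a ^+ 3 + b ^+ 3 + c ^+ 3.
Proof.
move=> a0 b0 c0.
have H (m : R) : a <= m -> b <= m -> c <= m -> a * b * c <= m ^+ 3.
  by move=> am bm cm; rewrite -mulrA !exprS expr0 mulr1 !ler_pM// mulr_ge0.
have [a3 b3 c3] : [/\ 0 <= a ^+ 3, 0 <= b ^+ 3 & 0 <= c ^+ 3].
  by rewrite !exprn_ge0.
have [ab|/ltW ba] := leP a b; have [bc|/ltW cb] := leP b c;
  have [ac|/ltW ca] := leP a c.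
- by have := H c ac bc (lexx c); lra.
- by have := H c (le_trans ab bc) bc (lexx c); lra.
- by have := H b ab (lexx b) cb; lra.
- by have := H b ab (lexx b) cb; lra.
- by have := H c ac bc (lexx c); lra.
- by have := H a (lexx a) ba ca; lra.
- by have := H a (lexx a) ba (le_trans cb ba); lra.
- by have := H a (lexx a) ba ca; lra.
Qed.

Lemma integrable_sqrDr1M (X U V : T -> R) k l m :
  all_moments X -> all_moments U -> all_moments V ->
  P.-integrable setT (EFin \o (fun w =>
    (1 + X w ^+ 2) ^+ k * (1 + U w ^+ 2) ^+ l * (1 + V w ^+ 2) ^+ m)).
Proof.
move=> aX aU aV.
have i1 := integrableD measurableT (integrableD measurableT
  (integrable_sqrDr1 (k * 3) aX) (integrable_sqrDr1 (l * 3) aU))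
  (integrable_sqrDr1 (m * 3) aV).
apply: le_integrable i1 => //.
  apply/measurable_EFinP; apply: measurable_funM; first apply: measurable_funM.
  - by apply: measurable_sqrDr1; case: aX.
  - by apply: measurable_sqrDr1; case: aU.
  - by apply: measurable_sqrDr1; case: aV.
move=> w _ /=; rewrite lee_fin.
have p x j : 0 <= (1 + x ^+ 2) ^+ j :> R by rewrite (le_trans ler01)// sqrDr1_ge1.
rewrite [leLHS]ger0_norm ?mulr_ge0// (le_trans _ (ler_norm _))//.
by rewrite !exprM; exact: mul3_le.
Qed.

Lemma integrable_poly_dominated (X U V : T -> R) (f g h : R -> R) :
  all_moments X -> all_moments U -> all_moments V ->
  poly_dominated f -> poly_dominated g -> poly_dominated h ->
  P.-integrable setT (EFin \o (fun w => f (X w) * g (U w) * h (V w))).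
Proof.
move=> aX aU aV [mf [Cf [k Hf]]] [mg [Cg [l Hg]]] [mh [Ch [m Hh]]].
have i1 := integrableZl measurableT (Cf * Cg * Ch)
  (integrable_sqrDr1M k l m aX aU aV).
apply: le_integrable i1 => //.
  apply/measurable_EFinP; apply: measurable_funM; first apply: measurable_funM.
  - by apply: measurableT_comp => //; case: aX.
  - by apply: measurableT_comp => //; case: aU.
  - by apply: measurableT_comp => //; case: aV.
move=> w _ /=; rewrite lee_fin (le_trans _ (ler_norm _))// !normrM.
apply: (@le_trans _ _ ((Cf * (1 + X w ^+ 2) ^+ k) * (Cg * (1 + U w ^+ 2) ^+ l)
   * (Ch * (1 + V w ^+ 2) ^+ m))).
  by rewrite !ler_pM ?mulr_ge0.
by rewrite le_eqVlt; apply/orP; left; apply/eqP; rewrite /=; ring.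
Qed.

(** The condition is linear in [f], and [iW] supplies the integrable majorant for the limit
    clause. *)
Lemma Rintegral_closure_eq0 (G : set (R -> R)) (Y W : T -> R) (f : R -> R) :
  G `<=` poly_dominated -> measurable_fun setT Y -> measurable_fun setT W ->
  (forall k, P.-integrable setT (EFin \o (fun w => (1 + Y w ^+ 2) ^+ k * W w))) ->
  (forall g, G g -> \int[P]_w (g (Y w) * W w) = 0) ->
  dominated_closure G f -> \int[P]_w (f (Y w) * W w) = 0.
Proof.
move=> GP mY mW iW HG.
have iD g : poly_dominated g -> P.-integrable setT (EFin \o (fun w => g (Y w) * W w)).
  move=> [mg [C [k Hg]]]; apply: le_integrable (integrableZl measurableT C (iW k)) => //.
    by apply/measurable_EFinP; apply: measurable_funM => //; exact: measurableT_comp.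
  move=> w _ /=; rewrite lee_fin !normrM mulrA ler_wpM2r//.
  by rewrite -normrM (le_trans (Hg _))// ler_norm.
have cP := dominated_closure_poly_dominated GP.
elim => {f}.
- exact: HG.
- move=> c f g hf IHf hg IHg.
  have i1 : P.-integrable setT (EFin \o (fun w => c * (f (Y w) * W w))).
    exact: integrableZl (iD _ (cP _ hf)).
  under eq_Rintegral do rewrite mulrDl -mulrA.
  rewrite RintegralD//; last exact: iD (cP _ hg).
  by rewrite RintegralZl ?IHf ?IHg ?mulr0 ?addr0//; exact: iD (cP _ hf).
- move=> f_ f C k hf IH bd lim.
  have lim1 : (\int[P]_w (f_ n (Y w) * W w)%:E)%E @[n --> \oo] -->
      (\int[P]_w (f (Y w) * W w)%:E)%E.
    apply: (@dominated_cvg _ _ _ P setT measurableT _ _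
      (fun w => (`|C * ((1 + Y w ^+ 2) ^+ k * W w)|)%:E)) => //.
    + by move=> n; apply: measurable_int (iD _ (cP _ (hf n))).
    + move=> w _; apply: cvg_EFin; first exact: nearW.
      by apply: cvgM => //; exact: cvg_cst.
    + exact: integrable_norm (integrableZl measurableT C (iW k)).
    + move=> n w _; rewrite lee_fin mulrA normrM [leRHS]normrM ler_wpM2r//.
      by rewrite (le_trans (bd _ _))// ler_norm.
  have e0 n : (\int[P]_w (f_ n (Y w) * W w)%:E = 0)%E.
    have := IH n; rewrite /Rintegral => h.
    rewrite -[LHS]fineK ?h//.
    exact: integrable_fin_num (iD _ (cP _ (hf n))).
  rewrite /Rintegral -(cvg_lim _ lim1)//.
  under eq_fun do rewrite e0.
  by rewrite lim_cst.
Qed.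

(** The factorisation says that the integral of [f (Y w) * (Z w - c)] vanishes, a condition linear
    in [f]. *)
Lemma Rintegral_closure_factor (G : set (R -> R)) (Y Z : T -> R) (c : R)
    (f : R -> R) :
  G `<=` poly_dominated -> all_moments Y -> measurable_fun setT Z ->
  (forall g, poly_dominated g ->
    P.-integrable setT (EFin \o (fun w => g (Y w) * Z w))) ->
  (forall g, G g -> \int[P]_w (g (Y w) * Z w) = \int[P]_w g (Y w) * c) ->
  dominated_closure G f ->
  \int[P]_w (f (Y w) * Z w) = \int[P]_w f (Y w) * c.
Proof.
move=> GP aY mZ iZ HG hf; have mY := aY.1.
have pk k : poly_dominated (fun x : R => (1 + x ^+ 2) ^+ k).
  split.
    exact: (measurable_sqrDr1 k (@measurable_id _ R setT)).
  exists 1, k => x; rewrite mul1r ger0_norm// (le_trans ler01)//.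
  exact: sqrDr1_ge1.
have iY g : poly_dominated g -> P.-integrable setT (EFin \o (fun w => g (Y w))).
  move=> [mg [C [k Hg]]].
  apply: le_integrable (integrableZl measurableT C (integrable_sqrDr1 k aY)) => //.
    by apply/measurable_EFinP; exact: measurableT_comp.
  by move=> w _ /=; rewrite lee_fin (le_trans (Hg _))// ler_norm.
have E g : poly_dominated g -> \int[P]_w (g (Y w) * (Z w - c)) =
    \int[P]_w (g (Y w) * Z w) - \int[P]_w g (Y w) * c.
  move=> Pg; rewrite -RintegralZr//; last exact: iY.
  rewrite -RintegralB//; last 2 first.
  - exact: iZ.
  - exact: integrableZr (iY _ Pg).
  by apply: eq_Rintegral => w _; rewrite mulrBr.
apply/eqP; rewrite -subr_eq0 -E; last first.
  exact: dominated_closure_poly_dominated hf.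
apply/eqP; apply: (Rintegral_closure_eq0 GP mY _ _ _ hf).
- exact: measurable_funB.
- move=> k; have := integrableB measurableT (iZ _ (pk k))
    (integrableZr measurableT c (iY _ (pk k))).
  by apply: eq_integrable => // w _ /=; rewrite mulrBr.
- by move=> g Gg; rewrite E ?HG ?subrr//; exact: GP.
Qed.

(** Generators are replaced by elements of the closure in one variable at a time, the product of the
    other two factors playing the role of [Z]. *)
Lemma Rintegral_closure_factor3 (G : set (R -> R)) (X U V : T -> R) :
  G `<=` poly_dominated ->
  all_moments X -> all_moments U -> all_moments V ->
  (forall f g h, G f -> G g -> G h ->
    \int[P]_w (f (X w) * g (U w) * h (V w)) =
    \int[P]_w f (X w) * \int[P]_w g (U w) * \int[P]_w h (V w)) ->
  forall f g h, dominated_closure G f -> dominated_closure G g ->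
    dominated_closure G h ->
    \int[P]_w (f (X w) * g (U w) * h (V w)) =
    \int[P]_w f (X w) * \int[P]_w g (U w) * \int[P]_w h (V w).
Proof.
move=> GP aX aU aV HG.
have cP := dominated_closure_poly_dominated GP.
have iD := integrable_poly_dominated aX aU aV.
have m2 (A B : T -> R) g h : all_moments A -> all_moments B ->
    poly_dominated g -> poly_dominated h ->
    measurable_fun setT (fun w => g (A w) * h (B w)).
  by move=> [mA _] [mB _] [mg _] [mh _]; apply: measurable_funM;
    exact: measurableT_comp.
have H1 f g h : dominated_closure G f -> G g -> G h ->
    \int[P]_w (f (X w) * g (U w) * h (V w)) =
    \int[P]_w f (X w) * \int[P]_w g (U w) * \int[P]_w h (V w).
  move=> hf Gg Gh; under eq_Rintegral do rewrite -mulrA.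
  rewrite -mulrA; apply: (Rintegral_closure_factor GP aX _ _ _ hf).
  - by apply: m2 => //; exact: GP.
  - move=> f' Pf'; have := iD _ _ _ Pf' (GP _ Gg) (GP _ Gh).
    by apply: eq_integrable => // w _ /=; rewrite mulrA.
  - by move=> f' Gf'; under eq_Rintegral do rewrite mulrA; rewrite HG// mulrA.
have H2 f g h : dominated_closure G f -> dominated_closure G g -> G h ->
    \int[P]_w (f (X w) * g (U w) * h (V w)) =
    \int[P]_w f (X w) * \int[P]_w g (U w) * \int[P]_w h (V w).
  move=> hf hg Gh; under eq_Rintegral do rewrite -mulrA mulrCA.
  rewrite -mulrA mulrCA; apply: (Rintegral_closure_factor GP aU _ _ _ hg).
  - by apply: m2 => //; [exact: cP | exact: GP].
  - move=> g' Pg'; have := iD _ _ _ (cP _ hf) Pg' (GP _ Gh).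
    by apply: eq_integrable => // w _ /=; rewrite -mulrA mulrCA.
  - move=> g' Gg'; under eq_Rintegral do rewrite mulrCA mulrA.
    by rewrite H1// -mulrA mulrCA.
move=> f g h hf hg hh; under eq_Rintegral do rewrite mulrC.
rewrite mulrC; apply: (Rintegral_closure_factor GP aV _ _ _ hh).
- by apply: m2 => //; exact: cP.
- move=> h' Ph'; have := iD _ _ _ (cP _ hf) (cP _ hg) Ph'.
  by apply: eq_integrable => // w _ /=; rewrite mulrC.
- move=> h' Gh'; under eq_Rintegral do rewrite mulrC.
  by rewrite H2// mulrC.
Qed.
End factor.

(** * Uncorrelated jointly Gaussian variables *)

Lemma poly_dominated_exprn (R : realType) k : poly_dominated (fun x : R => x ^+ k).
Proof.
exact: (dominated_closure_poly_dominated cosines_poly_dominated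
  (closure_cosines_exprn k)).
Qed.

Section uncorrelated.
Context d (T : measurableType d) (R : realType) (P : probability T R).

(** Stated for plain functions and closed under linear substitution, so it passes directly to the
    residuals of the regression. Centering is built in through [gaussian_moments]. *)
Definition jointly_gaussian (X U V : T -> R) :=
  forall a b c, gaussian_moments P (fun w => a * X w + b * U w + c * V w).

Lemma jointly_gaussian1 X U V : jointly_gaussian X U V -> gaussian_moments P X.
Proof.
move=> /(_ 1 0 0); congr gaussian_moments.
by apply/funext => w; ring.
Qed.

Lemma jointly_gaussian2 X U V : jointly_gaussian X U V -> gaussian_moments P U.
Proof.
move=> /(_ 0 1 0); congr gaussian_moments.
by apply/funext => w; ring.
Qed.

Lemma jointly_gaussian3 X U V : jointly_gaussian X U V -> gaussian_moments P V.
Proof.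
move=> /(_ 0 0 1); congr gaussian_moments.
by apply/funext => w; ring.
Qed.

Variables X U V : T -> R.
Hypothesis gXUV : jointly_gaussian X U V.

Let all_m (Y : T -> R) : gaussian_moments P Y -> all_moments P Y.
Proof. by move=> [mY iY _ _]; split. Qed.

Let aX := all_m (jointly_gaussian1 gXUV).
Let aU := all_m (jointly_gaussian2 gXUV).
Let aV := all_m (jointly_gaussian3 gXUV).

Lemma integrable_monomial i j k :
  P.-integrable setT (EFin \o (fun w => X w ^+ i * U w ^+ j * V w ^+ k)).
Proof.
exact: (integrable_poly_dominated aX aU aV (poly_dominated_exprn R i)
  (poly_dominated_exprn R j) (poly_dominated_exprn R k)).
Qed.

(** A polynomial in three variables is encoded as a list of coefficients with exponents. Linearity
    of the integral is then proved once, and explicit integrands are matched with such a list by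
    [ring]. *)
Lemma Rintegral_polynomial (s : seq (R * (nat * nat * nat))) :
  P.-integrable setT (EFin \o (fun w => \sum_(p <- s)
     p.1 * (X w ^+ p.2.1.1 * U w ^+ p.2.1.2 * V w ^+ p.2.2))) /\
  \int[P]_w (\sum_(p <- s)
     p.1 * (X w ^+ p.2.1.1 * U w ^+ p.2.1.2 * V w ^+ p.2.2)) =
  \sum_(p <- s) p.1 *
     \int[P]_w (X w ^+ p.2.1.1 * U w ^+ p.2.1.2 * V w ^+ p.2.2).
Proof.
elim: s => [|p s [IHi IHs]].
  rewrite big_nil; split.
    under [X in EFin \o X]eq_fun do rewrite big_nil.
    exact: finite_measure_integrable_cst.
  by under eq_Rintegral do rewrite big_nil; rewrite Rintegral_cst//= mul0r.
have im := integrable_monomial p.2.1.1 p.2.1.2 p.2.2.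
have i1 := integrableZl measurableT p.1 im.
split.
  apply: eq_integrable (integrableD measurableT i1 IHi) => // w _ /=.
  by rewrite big_cons.
under eq_Rintegral do rewrite big_cons.
by rewrite RintegralD// RintegralZl// IHs big_cons.
Qed.

Hypothesis XU0 : \int[P]_w (X w * U w) = 0.
Hypothesis XV0 : \int[P]_w (X w * V w) = 0.
Hypothesis UV0 : \int[P]_w (U w * V w) = 0.

Lemma Rintegral_uncorrelated_sqr a b c :
  \int[P]_w ((a * X w + b * U w + c * V w) ^+ 2) =
  a ^+ 2 * \int[P]_w (X w ^+ 2) + b ^+ 2 * \int[P]_w (U w ^+ 2) +
  c ^+ 2 * \int[P]_w (V w ^+ 2).
Proof.
have [_] := Rintegral_polynomial
  [:: (a ^+ 2, (2, 0, 0)%N); (b ^+ 2, (0, 2, 0)%N); (c ^+ 2, (0, 0, 2)%N);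
      (2 * a * b, (1, 1, 0)%N); (2 * a * c, (1, 0, 1)%N); (2 * b * c, (0, 1, 1)%N)].
rewrite !big_cons big_nil/= => h.
transitivity (\int[P]_w (\sum_(p <-
  [:: (a ^+ 2, (2, 0, 0)%N); (b ^+ 2, (0, 2, 0)%N); (c ^+ 2, (0, 0, 2)%N);
      (2 * a * b, (1, 1, 0)%N); (2 * a * c, (1, 0, 1)%N); (2 * b * c, (0, 1, 1)%N)])
   p.1 * (X w ^+ p.2.1.1 * U w ^+ p.2.1.2 * V w ^+ p.2.2))).
  by apply: eq_Rintegral => w _; rewrite !big_cons big_nil/=; ring.
rewrite h.
have -> : \int[P]_w (X w ^+ 2 * U w ^+ 0 * V w ^+ 0) = \int[P]_w (X w ^+ 2).
  by apply: eq_Rintegral => w _; ring.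
have -> : \int[P]_w (X w ^+ 0 * U w ^+ 2 * V w ^+ 0) = \int[P]_w (U w ^+ 2).
  by apply: eq_Rintegral => w _; ring.
have -> : \int[P]_w (X w ^+ 0 * U w ^+ 0 * V w ^+ 2) = \int[P]_w (V w ^+ 2).
  by apply: eq_Rintegral => w _; ring.
have -> : \int[P]_w (X w ^+ 1 * U w ^+ 1 * V w ^+ 0) = 0.
  by rewrite -[RHS]XU0; apply: eq_Rintegral => w _; ring.
have -> : \int[P]_w (X w ^+ 1 * U w ^+ 0 * V w ^+ 1) = 0.
  by rewrite -[RHS]XV0; apply: eq_Rintegral => w _; ring.
have -> : \int[P]_w (X w ^+ 0 * U w ^+ 1 * V w ^+ 1) = 0.
  by rewrite -[RHS]UV0; apply: eq_Rintegral => w _; ring.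
by ring.
Qed.

Let cos3 (x y z : R) : cos x * cos y * cos z =
  4^-1 * (cos (x + y + z) + cos (x + y - z) + cos (x - y + z) + cos (x - y - z)).
Proof. by rewrite !(cosD, sinD, cosN, sinN); field. Qed.

(** A product of three cosines is the mean of four cosines of linear combinations. Without
    correlation the variance of these does not depend on the signs, so all four expectations share
    one exponential factor, and the cosines of the phases recombine by the same identity. *)
Lemma Rintegral_cos_factor (t a s b r c : R) :
  \int[P]_w (cos (t * X w + a) * cos (s * U w + b) * cos (r * V w + c)) =
  \int[P]_w cos (t * X w + a) * \int[P]_w cos (s * U w + b) *
  \int[P]_w cos (r * V w + c).
Proof.
set vX := \int[P]_w (X w ^+ 2); set vU := \int[P]_w (U w ^+ 2).
set vV := \int[P]_w (V w ^+ 2).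
have E (t' s' r' e : R) : \int[P]_w cos (t' * X w + s' * U w + r' * V w + e) =
    cos e * expR (- ((t' ^+ 2 * vX + s' ^+ 2 * vU + r' ^+ 2 * vV) / 2)).
  rewrite (Rintegral_cos_gaussian (gXUV t' s' r')).
  by rewrite Rintegral_uncorrelated_sqr.
have iE (t' s' r' e : R) := integrable_cos_gaussian (gXUV t' s' r') e.
have E1 : \int[P]_w cos (t * X w + a) = cos a * expR (- (t ^+ 2 * vX / 2)).
  rewrite -[t ^+ 2 * vX](_ : t ^+ 2 * vX + 0 ^+ 2 * vU + 0 ^+ 2 * vV = _); last by ring.
  by rewrite -E; apply: eq_Rintegral => w _; congr cos; ring.
have E2 : \int[P]_w cos (s * U w + b) = cos b * expR (- (s ^+ 2 * vU / 2)).
  rewrite -[s ^+ 2 * vU](_ : 0 ^+ 2 * vX + s ^+ 2 * vU + 0 ^+ 2 * vV = _); last by ring.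
  by rewrite -E; apply: eq_Rintegral => w _; congr cos; ring.
have E3 : \int[P]_w cos (r * V w + c) = cos c * expR (- (r ^+ 2 * vV / 2)).
  rewrite -[r ^+ 2 * vV](_ : 0 ^+ 2 * vX + 0 ^+ 2 * vU + r ^+ 2 * vV = _); last by ring.
  by rewrite -E; apply: eq_Rintegral => w _; congr cos; ring.
rewrite E1 E2 E3.
transitivity (\int[P]_w (4^-1 * (
   cos (t * X w + s * U w + r * V w + (a + b + c)) +
   cos (t * X w + s * U w + (- r) * V w + (a + b - c)) +
   cos (t * X w + (- s) * U w + r * V w + (a - b + c)) +
   cos (t * X w + (- s) * U w + (- r) * V w + (a - b - c))))).
  apply: eq_Rintegral => w _; rewrite cos3; congr (_ * (_ + _ + _ + _));
    congr cos; ring.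
have i4 := iE t (- s) (- r) (a - b - c).
have i3 := iE t (- s) r (a - b + c).
have i2 := iE t s (- r) (a + b - c).
have i1 := iE t s r (a + b + c).
have i12 := integrableD measurableT i1 i2.
have i123 := integrableD measurableT i12 i3.
rewrite RintegralZl//; last exact: (integrableD measurableT i123 i4).
rewrite RintegralD// RintegralD// RintegralD// !E !sqrrN.
set eX := t ^+ 2 * vX; set eU := s ^+ 2 * vU; set eV := r ^+ 2 * vV.
have -> : - ((eX + eU + eV) / 2) = - (eX / 2) + - (eU / 2) + - (eV / 2) by field.
rewrite !expRD -!mulrDl mulrA -cos3; ring.
Qed.

Lemma Rintegral_uncorrelated_factor (f g h : R -> R) :
  dominated_closure cosines f -> dominated_closure cosines g ->
  dominated_closure cosines h ->
  \int[P]_w (f (X w) * g (U w) * h (V w)) =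
  \int[P]_w f (X w) * \int[P]_w g (U w) * \int[P]_w h (V w).
Proof.
apply: (Rintegral_closure_factor3 cosines_poly_dominated aX aU aV).
by move=> _ _ _ [t [a ->]] [s [b ->]] [r [c ->]]; exact: Rintegral_cos_factor.
Qed.

Lemma monomial_uncorrelated_factor i j k :
  \int[P]_w (X w ^+ i * U w ^+ j * V w ^+ k) =
  \int[P]_w (X w ^+ i) * \int[P]_w (U w ^+ j) * \int[P]_w (V w ^+ k).
Proof.
exact: (Rintegral_uncorrelated_factor (closure_cosines_exprn i)
  (closure_cosines_exprn j) (closure_cosines_exprn k)).
Qed.

Lemma prob_uncorrelated_factor (A B C : set R) :
  measurable A -> measurable B -> measurable C ->
  P (X @^-1` A `&` U @^-1` B `&` V @^-1` C) =
  (P (X @^-1` A) * P (U @^-1` B) * P (V @^-1` C))%E.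
Proof.
move=> mA mB mC.
have H := Rintegral_uncorrelated_factor (closure_cosines_indic mA)
  (closure_cosines_indic mB) (closure_cosines_indic mC).
have mpre (Y : T -> R) (D : set R) : measurable_fun setT Y -> measurable D ->
    measurable (Y @^-1` D).
  by move=> mY mD; rewrite -[X in measurable X]setTI; exact: mY.
have mX := mpre X A aX.1 mA.
have mU := mpre U B aU.1 mB.
have mV := mpre V C aV.1 mC.
have E D : measurable D -> P D = (\int[P]_w \1_D w)%:E.
  move=> mD; rewrite /Rintegral integral_indic// setIT fineK//.
  exact: fin_num_measure.
rewrite !E ?H//; last by apply: measurableI => //; exact: measurableI.
rewrite -!EFinM; congr EFin.
rewrite -H; apply: eq_Rintegral => w _.
have pre (Y : T -> R) D : (w \in Y @^-1` D) = (Y w \in D).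
  by apply/idP/idP; rewrite !inE.
rewrite !indicE !in_setI !pre.
by case: (_ \in A); case: (_ \in B); case: (_ \in C) => /=; ring.
Qed.
End uncorrelated.

(** * The quadratic form of the inequality *)

Section quadratic.
Variable R : realFieldType.

(** Completing the square in [b]: [A * Q] is a sum of three nonnegative terms. The conclusion is
    [e * u = 0] rather than [e = 0] because [u] may vanish. *)
Lemma moment_form_ge0 (v u w b e beta A B D W : R) :
  0 < v -> 0 <= u -> 0 <= w -> 0 < A -> 0 <= W ->
  0 < A * B - beta ^+ 2 * v * u * D ^+ 2 ->
  let Q := w * W + b ^+ 2 * v * A + e ^+ 2 * u * B + 2 * b * e * beta * v * u * D in
  0 <= Q /\ (Q = 0 -> [/\ w * W = 0, b = 0 & e * u = 0]).
Proof.
move=> v0 u0 w0 A0 W0 det0 Q.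
set det := A * B - _ in det0.
have AQ : A * Q = A * (w * W) + v * (b * A + e * beta * u * D) ^+ 2 +
    e ^+ 2 * u * det by rewrite /Q /det; ring.
have p1 : 0 <= A * (w * W) by rewrite !mulr_ge0// ltW.
have p2 : 0 <= v * (b * A + e * beta * u * D) ^+ 2.
  by apply: mulr_ge0; [exact: ltW|exact: sqr_ge0].
have p3 : 0 <= e ^+ 2 * u * det.
  by apply: mulr_ge0; [apply: mulr_ge0 => //; exact: sqr_ge0|exact: ltW].
split.
  have : 0 <= A * Q by rewrite AQ addr_ge0// addr_ge0.
  by rewrite pmulr_rge0.
move=> Q0; move: AQ; rewrite Q0 mulr0 => /esym AQ.
have /eqP e1 : A * (w * W) = 0 by lra.
have /eqP e2 : v * (b * A + e * beta * u * D) ^+ 2 = 0 by lra.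
have /eqP e3 : e ^+ 2 * u * det = 0 by lra.
have eu : e * u = 0.
  move: e3; rewrite !mulf_eq0 (gt_eqF det0) orbF orbb => /orP[] /eqP ->.
    by rewrite mul0r.
  by rewrite mulr0.
split => //.
- by move: e1; rewrite mulf_eq0 (gt_eqF A0)/= => /eqP.
- move: e2; rewrite mulf_eq0 (gt_eqF v0)/= sqrf_eq0.
  have -> : e * beta * u * D = (e * u) * beta * D by ring.
  by rewrite eu !mul0r addr0 mulf_eq0 (gt_eqF A0) orbF => /eqP.
Qed.

Section coefficients.
Variables N x u : R.
Hypotheses (N0 : 0 < N) (x0 : 0 <= x) (u0 : 0 <= u) (xu0 : 0 < x + u).

Let N0' : 0 <= N. Proof. exact: ltW. Qed.

Ltac nonneg := repeat match goal with
  | H : ?A |- ?A => exact H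
  | |- is_true (0 <= _ + _) => apply: addr_ge0
  | |- is_true (0 <= _ * _) => apply: mulr_ge0
  | |- is_true (0 <= _ ^+ _) => apply: exprn_ge0
  | |- is_true (0 <= _%:R) => exact: ler0n
  end.

(* With [Y = beta X + U], [p = 4] or [6], [M = E[X^N]] and [c = 3] or [15]:
   [A] is [E[X^2 Y^p X^N] / (v M) - c (x + u)^(p/2)],
   [B] is [E[U^2 Y^p X^N] / (u M) - c (x + u)^(p/2)],
   [D] is [E[X U Y^p X^N] / (beta v u M)],
   [W] is [E[Y^p X^N] / M - c (x + u)^(p/2)]. *)
Definition coefA4 : R := (N + 1) * (3 * u ^+ 2 + 6 * (N + 3) * x * u
  + (N + 3) * (N + 5) * x ^+ 2) - 3 * (x + u) ^+ 2.
Definition coefB4 : R := 15 * u ^+ 2 + 18 * (N + 1) * x * u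
  + (N + 1) * (N + 3) * x ^+ 2 - 3 * (x + u) ^+ 2.
Definition coefD4 : R := 4 * (N + 1) * (3 * u + (N + 3) * x).
Definition coefW4 : R := 3 * u ^+ 2 + 6 * (N + 1) * x * u
  + (N + 1) * (N + 3) * x ^+ 2 - 3 * (x + u) ^+ 2.

Definition coefA6 : R := (N + 1) * (15 * u ^+ 3 + 45 * (N + 3) * x * u ^+ 2
  + 15 * (N + 3) * (N + 5) * x ^+ 2 * u
  + (N + 3) * (N + 5) * (N + 7) * x ^+ 3) - 15 * (x + u) ^+ 3.
Definition coefB6 : R := 105 * u ^+ 3 + 225 * (N + 1) * x * u ^+ 2
  + 45 * (N + 1) * (N + 3) * x ^+ 2 * u
  + (N + 1) * (N + 3) * (N + 5) * x ^+ 3 - 15 * (x + u) ^+ 3.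
Definition coefD6 : R := 6 * (N + 1) * (15 * u ^+ 2 + 10 * (N + 3) * x * u
  + (N + 3) * (N + 5) * x ^+ 2).
Definition coefW6 : R := 15 * u ^+ 3 + 45 * (N + 1) * x * u ^+ 2
  + 15 * (N + 1) * (N + 3) * x ^+ 2 * u
  + (N + 1) * (N + 3) * (N + 5) * x ^+ 3 - 15 * (x + u) ^+ 3.

(** All coefficients of the expansion are nonnegative, and its first summand is positive because [x]
    or [u] is. *)
Lemma coefA4_gt0 : 0 < coefA4.
Proof.
have -> : coefA4 = (3 * u ^+ 2 + 11 * x ^+ 2) * N + x ^+ 2 * N
  + (6 * N ^+ 2 + 24 * N + 12) * (x * u)
  + (N ^+ 3 + 9 * N ^+ 2 + 11 * N + 12) * x ^+ 2.
  by rewrite /coefA4; ring.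
apply: ltr_pwDl; last by nonneg.
apply: ltr_pwDl; last by nonneg.
apply: ltr_pwDl; last by nonneg.
rewrite mulr_gt0//.
have [xg|xl] := ltP 0 x.
  by apply: ltr_wpDl; [nonneg|rewrite mulr_gt0// exprn_gt0].
have ug : 0 < u by move: xu0; lra.
by apply: ltr_pwDl; [rewrite mulr_gt0// exprn_gt0|nonneg].
Qed.

(** For [x = 0] the variable [Y] is [U], independent of [X], and the difference vanishes; this
    explains the factor [x]. *)
Lemma coefW4_ge0 : 0 <= coefW4.
Proof.
have -> : coefW4 = x * (6 * N * u + (N ^+ 2 + 4 * N) * x).
  by rewrite /coefW4; ring.
by nonneg.
Qed.

Lemma coefW4_eq0 : coefW4 = 0 -> x = 0.
Proof.
have -> : coefW4 = x * (6 * N * u) + x ^+ 2 * (N ^+ 2) + 4 * N * x ^+ 2.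
  by rewrite /coefW4; ring.
have h1 : 0 <= x * (6 * N * u) by nonneg.
have h2 : 0 <= x ^+ 2 * N ^+ 2 by nonneg.
have h3 : 0 <= 4 * N * x ^+ 2 by nonneg.
move=> h; have /eqP : 4 * N * x ^+ 2 = 0 by lra.
by rewrite !mulf_eq0 pnatr_eq0 (gt_eqF N0)/= orbb => /eqP.
Qed.

(** The case split provides a strictly positive term: [36 * N * u ^+ 4] when [x = 0], and otherwise
    [48 * N * x ^+ 4], since the square in the expansion may vanish for positive [x]. *)
Lemma det4_gt0 : 0 < coefA4 * coefB4 - x * u * coefD4 ^+ 2.
Proof.
have [xg|xl] := ltP 0 x; last first.
  have xE : x = 0 by move: x0; lra.
  have ug : 0 < u by move: xu0; lra.
  rewrite (_ : _ - _ = 36 * N * u ^+ 4); last first.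
    by rewrite /coefA4 /coefB4 /coefD4 xE; ring.
  by apply: mulr_gt0; [apply: mulr_gt0; rewrite ?ltr0n|apply: exprn_gt0].
(* For [N > 2] the coefficient of [x u^3] is negative; the square absorbs it. *)
have -> : coefA4 * coefB4 - x * u * coefD4 ^+ 2 =
  48 * N * x ^+ 4 + 9 * N * u ^+ 2 * (2 * u - N / 2 * x) ^+ 2
  + 36 * N * x * u ^+ 3
  + (99 / 4 * N ^+ 3 + 144 * N ^+ 2 + 108 * N) * (x ^+ 2 * u ^+ 2)
  + (8 * N ^+ 4 + 94 * N ^+ 3 + 278 * N ^+ 2 + 156 * N) * (x ^+ 3 * u)
  + (N ^+ 5 + 13 * N ^+ 4 + 59 * N ^+ 3 + 104 * N ^+ 2) * x ^+ 4.
  by rewrite /coefA4 /coefB4 /coefD4; field.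
have q0 : 0 <= 99 / 4 :> R by lra.
have s0 := sqr_ge0 (2 * u - N / 2 * x).
apply: ltr_pwDl; last by nonneg.
apply: ltr_pwDl; last by nonneg.
apply: ltr_pwDl; last by nonneg.
apply: ltr_pwDl; last by nonneg.
apply: ltr_pwDl; last by nonneg.
by apply: mulr_gt0; [apply: mulr_gt0; rewrite ?ltr0n|apply: exprn_gt0].
Qed.

Lemma coefA6_gt0 : 0 < coefA6.
Proof.
have -> : coefA6 = (15 * u ^+ 3 + x ^+ 3) * N
  + (45 * N ^+ 2 + 180 * N + 90) * (x * u ^+ 2)
  + (15 * N ^+ 3 + 135 * N ^+ 2 + 345 * N + 180) * (x ^+ 2 * u)
  + (N ^+ 4 + 16 * N ^+ 3 + 86 * N ^+ 2 + 175 * N + 90) * x ^+ 3.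
  by rewrite /coefA6; ring.
apply: ltr_pwDl; last by nonneg.
apply: ltr_pwDl; last by nonneg.
apply: ltr_pwDl; last by nonneg.
rewrite mulr_gt0//.
have [xg|xl] := ltP 0 x.
  by apply: ltr_wpDl; [nonneg|rewrite exprn_gt0].
have ug : 0 < u by move: xu0; lra.
by apply: ltr_pwDl; [rewrite mulr_gt0// exprn_gt0|nonneg].
Qed.

Lemma coefW6_ge0 : 0 <= coefW6.
Proof.
have -> : coefW6 = x * (45 * N * u ^+ 2 + (15 * N ^+ 2 + 60 * N) * (x * u) +
  (N ^+ 3 + 9 * N ^+ 2 + 23 * N) * x ^+ 2) by rewrite /coefW6; ring.
by nonneg.
Qed.

Lemma coefW6_eq0 : coefW6 = 0 -> x = 0.
Proof.
have -> : coefW6 = x * (45 * N * u ^+ 2 + (15 * N ^+ 2 + 60 * N) * (x * u) +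
  (N ^+ 3 + 9 * N ^+ 2) * x ^+ 2) + 23 * N * x ^+ 3 by rewrite /coefW6; ring.
set p := x * _; have h1 : 0 <= p by rewrite /p; nonneg.
have h3 : 0 <= 23 * N * x ^+ 3 by nonneg.
move=> h; have /eqP : 23 * N * x ^+ 3 = 0 by lra.
by rewrite !mulf_eq0 pnatr_eq0 (gt_eqF N0)/= !orbb => /eqP.
Qed.

Lemma det6_gt0 : 0 < coefA6 * coefB6 - x * u * coefD6 ^+ 2.
Proof.
have [xg|xl] := ltP 0 x; last first.
  have xE : x = 0 by move: x0; lra.
  have ug : 0 < u by move: xu0; lra.
  rewrite (_ : _ - _ = 90 * (15 * N) * u ^+ 6); last first.
    by rewrite /coefA6 /coefB6 /coefD6 xE; ring.
  by apply: mulr_gt0; [rewrite !pmulr_rgt0 ?ltr0n|apply: exprn_gt0].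
(* The only coefficient that can be negative is that of [x * u ^+ 5], namely [2700 N - 675 N^2],
   when [N > 4]; completing the square with [u - N / 4 * x] absorbs it. *)
have E : coefA6 * coefB6 - x * u * coefD6 ^+ 2 =
  90 * (23 * N) * x ^+ 6 + 90 * (15 * N) * u ^+ 4 * (u - N / 4 * x) ^+ 2
  + 90 * (30 * N) * x * u ^+ 5
  + 675 * (15 / 8 * N ^+ 3 + 14 * N ^+ 2 + 14 * N) * (x ^+ 2 * u ^+ 4)
  + 75 * (11 * N ^+ 4 + 150 * N ^+ 3 + 490 * N ^+ 2 + 312 * N)
    * (x ^+ 3 * u ^+ 3)
  + 45 * (5 * N ^+ 5 + 84 * N ^+ 4 + 478 * N ^+ 3 + 60 * (17 * N ^+ 2)
    + 546 * N) * (x ^+ 4 * u ^+ 2)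
  + 3 * (8 * N ^+ 6 + 174 * N ^+ 5 + 13 * (107 * N ^+ 4) + 66 * (77 * N ^+ 3)
    + 80 * (101 * N ^+ 2) + 7 * N ^+ 2 + 60 * (63 * N)) * (x ^+ 5 * u)
  + (N ^+ 7 + 25 * N ^+ 6 + 253 * N ^+ 5 + 2 * (659 * N ^+ 4)
    + 44 * (83 * N ^+ 3) + 14 * (347 * N ^+ 2)) * x ^+ 6.
  by rewrite /coefA6 /coefB6 /coefD6; field.
rewrite E.
have q0 : 0 <= 15 / 8 :> R by lra.
have s0 := sqr_ge0 (u - N / 4 * x).
apply: ltr_pwDl; last by nonneg.
apply: ltr_pwDl; last by nonneg.
apply: ltr_pwDl; last by nonneg.
apply: ltr_pwDl; last by nonneg.
apply: ltr_pwDl; last by nonneg.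
apply: ltr_pwDl; last by nonneg.
apply: ltr_pwDl; last by nonneg.
by apply: mulr_gt0; [rewrite !pmulr_rgt0 ?ltr0n|apply: exprn_gt0].
Qed.
End coefficients.
End quadratic.

(** * Explicit moments in terms of the variance *)

Section moments.
Context d (T : measurableType d) (R : realType) (P : probability T R).
Variables (Y : T -> R).
Hypothesis gY : gaussian_moments P Y.

Let M0 : \int[P]_w (Y w ^+ 0) = 1.
Proof.
under eq_Rintegral do rewrite expr0.
by rewrite Rintegral_cst//= mul1r probability_setT.
Qed.

Let M1 : \int[P]_w (Y w ^+ 1) = 0.
Proof. by case: gY => _ _ + _; under [in X in _ -> X]eq_Rintegral do rewrite expr1. Qed.

(** The default value is meant for odd orders. The table stops at 8, the largest total degree of the
    factors in [X1] and [X2]. *)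
Definition gaussian_moment (v : R) (k : nat) : R :=
  match k with
  | 0 => 1 | 2 => v | 4 => 3 * v ^+ 2 | 6 => 15 * v ^+ 3 | 8 => 105 * v ^+ 4
  | _ => 0
  end.

Lemma gaussian_momentE k : (k < 9)%N ->
  \int[P]_w (Y w ^+ k) = gaussian_moment (\int[P]_w (Y w ^+ 2)) k.
Proof.
have [_ _ _ YS] := gY.
case: k => [|[|[|k]]] //.
set v := \int[P]_w (Y w ^+ 2) in YS *.
have M3 : \int[P]_w (Y w ^+ 3) = 0 by rewrite YS M1; ring.
have M4 : \int[P]_w (Y w ^+ 4) = 3 * v ^+ 2 by rewrite YS -/v; ring.
have M5 : \int[P]_w (Y w ^+ 5) = 0 by rewrite YS M3; ring.
have M6 : \int[P]_w (Y w ^+ 6) = 15 * v ^+ 3 by rewrite YS M4; ring.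
have M7 : \int[P]_w (Y w ^+ 7) = 0 by rewrite YS M5; ring.
have M8 : \int[P]_w (Y w ^+ 8) = 105 * v ^+ 4 by rewrite YS M6; ring.
by case: k => [|[|[|[|[|[|]]]]]].
Qed.

(** The ratio [E[Y^(N+k)] / E[Y^N]] for even [N], as a polynomial in [N]; with [N] kept symbolic the
    exponent of [X3] stays arbitrary. *)
Definition shifted_moment (N v : R) (k : nat) : R :=
  match k with
  | 0 => 1 | 2 => (N + 1) * v | 4 => (N + 1) * (N + 3) * v ^+ 2
  | 6 => (N + 1) * (N + 3) * (N + 5) * v ^+ 3
  | 8 => (N + 1) * (N + 3) * (N + 5) * (N + 7) * v ^+ 4
  | _ => 0
  end.

Lemma shifted_momentE j k : (k < 9)%N ->
  \int[P]_w (Y w ^+ (j.*2 + k)) = \int[P]_w (Y w ^+ j.*2) *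
    shifted_moment j.*2%:R (\int[P]_w (Y w ^+ 2)) k.
Proof.
have [_ _ _ YS] := gY.
set v := \int[P]_w (Y w ^+ 2) in YS *; set n := j.*2.
have E i : \int[P]_w (Y w ^+ (n + i.+2)) =
    (n%:R + i%:R + 1) * v * \int[P]_w (Y w ^+ (n + i)).
  by rewrite !addnS YS -natr1 natrD.
have M0' : \int[P]_w (Y w ^+ (n + 0)) = \int[P]_w (Y w ^+ n) by rewrite addn0.
have M1' : \int[P]_w (Y w ^+ (n + 1)) = 0.
  by rewrite addn1; exact: odd_moment_gaussian.
set M := \int[P]_w (Y w ^+ n) in M0' *.
have M2 : \int[P]_w (Y w ^+ (n + 2)) = M * ((n%:R + 1) * v).
  by rewrite E M0'; ring.
have M3 : \int[P]_w (Y w ^+ (n + 3)) = 0 by rewrite E M1'; ring.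
have M4 : \int[P]_w (Y w ^+ (n + 4)) = M * ((n%:R + 1) * (n%:R + 3) * v ^+ 2).
  by rewrite E M2; ring.
have M5 : \int[P]_w (Y w ^+ (n + 5)) = 0 by rewrite E M3; ring.
have M6 : \int[P]_w (Y w ^+ (n + 6)) =
    M * ((n%:R + 1) * (n%:R + 3) * (n%:R + 5) * v ^+ 3).
  by rewrite E M4; ring.
have M7 : \int[P]_w (Y w ^+ (n + 7)) = 0 by rewrite E M5; ring.
have M8 : \int[P]_w (Y w ^+ (n + 8)) =
    M * ((n%:R + 1) * (n%:R + 3) * (n%:R + 5) * (n%:R + 7) * v ^+ 4).
  by rewrite E M6; ring.
by case: k => [|[|[|[|[|[|[|[|[|]]]]]]]]]//= _;
  rewrite ?M0' ?M1' ?M2 ?M3 ?M4 ?M5 ?M6 ?M7 ?M8 ?mulr1 ?mulr0.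
Qed.
End moments.

(** * Expansion of the mixed moments *)

Section forms.
Context d (T : measurableType d) (R : realType) (P : probability T R).
Variables X U V : T -> R.
Hypothesis gXUV : jointly_gaussian P X U V.
Hypothesis XU0 : \int[P]_w (X w * U w) = 0.
Hypothesis XV0 : \int[P]_w (X w * V w) = 0.
Hypothesis UV0 : \int[P]_w (U w * V w) = 0.
Variables (b e beta : R) (j : nat).
Local Notation n := j.*2.
Local Notation v := (\int[P]_w (X w ^+ 2)).
Local Notation u := (\int[P]_w (U w ^+ 2)).
Local Notation t := (\int[P]_w (V w ^+ 2)).

Let MX k : (k < 9)%N -> \int[P]_w (X w ^+ (n + k)) =
  \int[P]_w (X w ^+ n) * shifted_moment n%:R v k.
Proof. exact: shifted_momentE (jointly_gaussian1 gXUV) _ _. Qed.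
Let MU k : (k < 9)%N -> \int[P]_w (U w ^+ k) = gaussian_moment u k.
Proof. exact: gaussian_momentE (jointly_gaussian2 gXUV) _. Qed.
Let MV k : (k < 9)%N -> \int[P]_w (V w ^+ k) = gaussian_moment t k.
Proof. exact: gaussian_momentE (jointly_gaussian3 gXUV) _. Qed.

(** Every monomial integrates to a product of one-variable moments, all with the common factor
    [E[X^n]]. The bound 9 is the range of the two moment tables. *)
Lemma Rintegral_shifted_polynomial (s : seq (R * (nat * nat * nat))) :
  all (fun p => [&& p.2.1.1 < 9, p.2.1.2 < 9 & p.2.2 < 9]%N) s ->
  \int[P]_w (\sum_(p <- s)
    p.1 * (X w ^+ (n + p.2.1.1) * U w ^+ p.2.1.2 * V w ^+ p.2.2)) =
  \int[P]_w (X w ^+ n) * \sum_(p <- s)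
    p.1 * (shifted_moment n%:R v p.2.1.1 * gaussian_moment u p.2.1.2 *
           gaussian_moment t p.2.2).
Proof.
move=> /allP s9.
have [_] := Rintegral_polynomial gXUV
  [seq (p.1, ((n + p.2.1.1)%N, p.2.1.2, p.2.2)) | p <- s].
rewrite !big_map/= => h.
transitivity (\int[P]_w (\sum_(p <- [seq (p.1, ((n + p.2.1.1)%N, p.2.1.2, p.2.2)) | p <- s])
    p.1 * (X w ^+ p.2.1.1 * U w ^+ p.2.1.2 * V w ^+ p.2.2))).
  by apply: eq_Rintegral => w _; rewrite big_map.
rewrite h mulr_sumr; apply: eq_big_seq => p ps.
have /and3P[p1 p2 p3] := s9 p ps.
rewrite (monomial_uncorrelated_factor gXUV XU0 XV0 UV0) MX// MU// MV//.
by rewrite -!mulrA mulrCA.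
Qed.

(** The expansion of [(b X + e U + V)^2 (beta X + U)^4]: one block for each of [b^2], [e^2], [1],
    [2 b e], [2 b], [2 e], each with the binomial coefficients of the fourth power. *)
Let terms4 : seq (R * (nat * nat * nat)) :=
  [:: (b ^+ 2 * (1 * beta ^+ 4), (6, 0, 0)%N); (b ^+ 2 * (4 * beta ^+ 3), (5, 1, 0)%N);
    (b ^+ 2 * (6 * beta ^+ 2), (4, 2, 0)%N); (b ^+ 2 * (4 * beta ^+ 1), (3, 3, 0)%N);
    (b ^+ 2 * (1 * beta ^+ 0), (2, 4, 0)%N); (e ^+ 2 * (1 * beta ^+ 4), (4, 2, 0)%N);
    (e ^+ 2 * (4 * beta ^+ 3), (3, 3, 0)%N); (e ^+ 2 * (6 * beta ^+ 2), (2, 4, 0)%N);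
    (e ^+ 2 * (4 * beta ^+ 1), (1, 5, 0)%N); (e ^+ 2 * (1 * beta ^+ 0), (0, 6, 0)%N);
    (1 * (1 * beta ^+ 4), (4, 0, 2)%N); (1 * (4 * beta ^+ 3), (3, 1, 2)%N);
    (1 * (6 * beta ^+ 2), (2, 2, 2)%N); (1 * (4 * beta ^+ 1), (1, 3, 2)%N);
    (1 * (1 * beta ^+ 0), (0, 4, 2)%N); (2 * b * e * (1 * beta ^+ 4), (5, 1, 0)%N);
    (2 * b * e * (4 * beta ^+ 3), (4, 2, 0)%N); (2 * b * e * (6 * beta ^+ 2), (3, 3, 0)%N);
    (2 * b * e * (4 * beta ^+ 1), (2, 4, 0)%N); (2 * b * e * (1 * beta ^+ 0), (1, 5, 0)%N);
    (2 * b * (1 * beta ^+ 4), (5, 0, 1)%N); (2 * b * (4 * beta ^+ 3), (4, 1, 1)%N);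
    (2 * b * (6 * beta ^+ 2), (3, 2, 1)%N); (2 * b * (4 * beta ^+ 1), (2, 3, 1)%N);
    (2 * b * (1 * beta ^+ 0), (1, 4, 1)%N); (2 * e * (1 * beta ^+ 4), (4, 1, 1)%N);
    (2 * e * (4 * beta ^+ 3), (3, 2, 1)%N); (2 * e * (6 * beta ^+ 2), (2, 3, 1)%N);
    (2 * e * (4 * beta ^+ 1), (1, 4, 1)%N); (2 * e * (1 * beta ^+ 0), (0, 5, 1)%N)].

(** The product of expectations is subtracted within [coefA4], [coefB4] and [coefW4]; the summand
    with factor 3 restores it, being [E[X1^2] E[X2^4]] in the regression variables. *)
Lemma Rintegral_gaussian_form4 :
  \int[P]_w ((b * X w + e * U w + V w) ^+ 2 * (beta * X w + U w) ^+ 4 * X w ^+ n) =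
  \int[P]_w (X w ^+ n) *
  (3 * (b ^+ 2 * v + e ^+ 2 * u + t) * (beta ^+ 2 * v + u) ^+ 2 +
   (t * coefW4 n%:R (beta ^+ 2 * v) u + b ^+ 2 * v * coefA4 n%:R (beta ^+ 2 * v) u
    + e ^+ 2 * u * coefB4 n%:R (beta ^+ 2 * v) u
    + 2 * b * e * beta * v * u * coefD4 n%:R (beta ^+ 2 * v) u)).
Proof.
transitivity (\int[P]_w (\sum_(p <- terms4)
    p.1 * (X w ^+ (n + p.2.1.1) * U w ^+ p.2.1.2 * V w ^+ p.2.2))).
  apply: eq_Rintegral => w _; rewrite /terms4 !big_cons big_nil/= !exprD.
  by move: (X w ^+ n) (X w) (U w) (V w) => a x y z; ring.
rewrite Rintegral_shifted_polynomial// /terms4 !big_cons big_nil/=.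
congr (_ * _).
rewrite /coefW4 /coefA4 /coefB4 /coefD4.
move: (n%:R : R) v u t => N a c z.
by ring.
Qed.

Let terms6 : seq (R * (nat * nat * nat)) :=
  [:: (b ^+ 2 * (1 * beta ^+ 6), (8, 0, 0)%N); (b ^+ 2 * (6 * beta ^+ 5), (7, 1, 0)%N);
    (b ^+ 2 * (15 * beta ^+ 4), (6, 2, 0)%N); (b ^+ 2 * (20 * beta ^+ 3), (5, 3, 0)%N);
    (b ^+ 2 * (15 * beta ^+ 2), (4, 4, 0)%N); (b ^+ 2 * (6 * beta ^+ 1), (3, 5, 0)%N);
    (b ^+ 2 * (1 * beta ^+ 0), (2, 6, 0)%N); (e ^+ 2 * (1 * beta ^+ 6), (6, 2, 0)%N);
    (e ^+ 2 * (6 * beta ^+ 5), (5, 3, 0)%N); (e ^+ 2 * (15 * beta ^+ 4), (4, 4, 0)%N);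
    (e ^+ 2 * (20 * beta ^+ 3), (3, 5, 0)%N); (e ^+ 2 * (15 * beta ^+ 2), (2, 6, 0)%N);
    (e ^+ 2 * (6 * beta ^+ 1), (1, 7, 0)%N); (e ^+ 2 * (1 * beta ^+ 0), (0, 8, 0)%N);
    (1 * (1 * beta ^+ 6), (6, 0, 2)%N); (1 * (6 * beta ^+ 5), (5, 1, 2)%N);
    (1 * (15 * beta ^+ 4), (4, 2, 2)%N); (1 * (20 * beta ^+ 3), (3, 3, 2)%N);
    (1 * (15 * beta ^+ 2), (2, 4, 2)%N); (1 * (6 * beta ^+ 1), (1, 5, 2)%N);
    (1 * (1 * beta ^+ 0), (0, 6, 2)%N); (2 * b * e * (1 * beta ^+ 6), (7, 1, 0)%N);
    (2 * b * e * (6 * beta ^+ 5), (6, 2, 0)%N); (2 * b * e * (15 * beta ^+ 4), (5, 3, 0)%N);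
    (2 * b * e * (20 * beta ^+ 3), (4, 4, 0)%N); (2 * b * e * (15 * beta ^+ 2), (3, 5, 0)%N);
    (2 * b * e * (6 * beta ^+ 1), (2, 6, 0)%N); (2 * b * e * (1 * beta ^+ 0), (1, 7, 0)%N);
    (2 * b * (1 * beta ^+ 6), (7, 0, 1)%N); (2 * b * (6 * beta ^+ 5), (6, 1, 1)%N);
    (2 * b * (15 * beta ^+ 4), (5, 2, 1)%N); (2 * b * (20 * beta ^+ 3), (4, 3, 1)%N);
    (2 * b * (15 * beta ^+ 2), (3, 4, 1)%N); (2 * b * (6 * beta ^+ 1), (2, 5, 1)%N);
    (2 * b * (1 * beta ^+ 0), (1, 6, 1)%N); (2 * e * (1 * beta ^+ 6), (6, 1, 1)%N);
    (2 * e * (6 * beta ^+ 5), (5, 2, 1)%N); (2 * e * (15 * beta ^+ 4), (4, 3, 1)%N);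
    (2 * e * (20 * beta ^+ 3), (3, 4, 1)%N); (2 * e * (15 * beta ^+ 2), (2, 5, 1)%N);
    (2 * e * (6 * beta ^+ 1), (1, 6, 1)%N); (2 * e * (1 * beta ^+ 0), (0, 7, 1)%N)].

Lemma Rintegral_gaussian_form6 :
  \int[P]_w ((b * X w + e * U w + V w) ^+ 2 * (beta * X w + U w) ^+ 6 * X w ^+ n) =
  \int[P]_w (X w ^+ n) *
  (15 * (b ^+ 2 * v + e ^+ 2 * u + t) * (beta ^+ 2 * v + u) ^+ 3 +
   (t * coefW6 n%:R (beta ^+ 2 * v) u + b ^+ 2 * v * coefA6 n%:R (beta ^+ 2 * v) u
    + e ^+ 2 * u * coefB6 n%:R (beta ^+ 2 * v) u
    + 2 * b * e * beta * v * u * coefD6 n%:R (beta ^+ 2 * v) u)).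
Proof.
transitivity (\int[P]_w (\sum_(p <- terms6)
    p.1 * (X w ^+ (n + p.2.1.1) * U w ^+ p.2.1.2 * V w ^+ p.2.2))).
  apply: eq_Rintegral => w _; rewrite /terms6 !big_cons big_nil/= !exprD.
  by move: (X w ^+ n) (X w) (U w) (V w) => a x y z; ring.
rewrite Rintegral_shifted_polynomial// /terms6 !big_cons big_nil/=.
congr (_ * _).
rewrite /coefW6 /coefA6 /coefB6 /coefD6.
move: (n%:R : R) v u t => N a c z.
by ring.
Qed.
End forms.

(** * Covariances and linear regression *)

Section covariance.
Context d (T : measurableType d) (R : realType) (P : probability T R).
Implicit Types X U V Y : T -> R.

Lemma even_moment_gt0 Y j : gaussian_moments P Y -> 0 < \int[P]_w (Y w ^+ 2) ->
  0 < \int[P]_w (Y w ^+ j.*2).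
Proof.
move=> gY v0; have [_ _ _ YS] := gY.
elim: j => [|j IHj]; first by rewrite (gaussian_momentE gY (ltn0Sn 8)).
by rewrite doubleS YS mulr_gt0// mulr_gt0.
Qed.

Lemma jointly_gaussian_linear X U V (a b c a' b' c' a'' b'' c'' : R) :
  jointly_gaussian P X U V ->
  jointly_gaussian P (fun w => a * X w + b * U w + c * V w)
    (fun w => a' * X w + b' * U w + c' * V w)
    (fun w => a'' * X w + b'' * U w + c'' * V w).
Proof.
move=> g x y z.
have := g (x * a + y * a' + z * a'') (x * b + y * b' + z * b'')
  (x * c + y * c' + z * c'').
by congr gaussian_moments; apply/funext => w; ring.
Qed.

Lemma Rintegral_bilinear X U V (a b c a' b' c' : R) : jointly_gaussian P X U V ->
  \int[P]_w ((a * X w + b * U w + c * V w) * (a' * X w + b' * U w + c' * V w)) =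
  a * a' * \int[P]_w (X w ^+ 2) + b * b' * \int[P]_w (U w ^+ 2) +
  c * c' * \int[P]_w (V w ^+ 2) + (a * b' + b * a') * \int[P]_w (X w * U w) +
  (a * c' + c * a') * \int[P]_w (X w * V w) +
  (b * c' + c * b') * \int[P]_w (U w * V w).
Proof.
move=> g.
pose s := [:: (a * a', (2, 0, 0)%N); (b * b', (0, 2, 0)%N); (c * c', (0, 0, 2)%N);
  (a * b' + b * a', (1, 1, 0)%N); (a * c' + c * a', (1, 0, 1)%N);
  (b * c' + c * b', (0, 1, 1)%N)].
have [_ h] := Rintegral_polynomial g s.
transitivity (\int[P]_w (\sum_(p <- s)
    p.1 * (X w ^+ p.2.1.1 * U w ^+ p.2.1.2 * V w ^+ p.2.2))).
  by apply: eq_Rintegral => w _; rewrite /s !big_cons big_nil/=; ring.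
rewrite h /s !big_cons big_nil/= addr0 !addrA.
by congr (_ * _ + _ * _ + _ * _ + _ * _ + _ * _ + _ * _);
  apply: eq_Rintegral => w _; ring.
Qed.

(** If [E[U^2] = 0], then [E[(t U + Y)^2]] is affine in [t] and nonnegative, so its slope [2 c] is
    zero. Otherwise the chosen [t] would give it the value -1. *)
Lemma gaussian_sqr_eq0_cov U Y X : jointly_gaussian P U Y X ->
  \int[P]_w (U w ^+ 2) = 0 -> \int[P]_w (U w * Y w) = 0.
Proof.
move=> g u0; set c := \int[P]_w (U w * Y w); set y := \int[P]_w (Y w ^+ 2).
have H t : 0 <= 2 * t * c + y.
  have := Rintegral_bilinear t 1 0 t 1 0 g.
  rewrite u0 -/c -/y => E.
  rewrite (_ : _ + _ = \int[P]_w ((t * U w + 1 * Y w + 0 * X w) *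
    (t * U w + 1 * Y w + 0 * X w))); last by rewrite E; ring.
  by apply: Rintegral_ge0 => w _; rewrite -expr2 sqr_ge0.
apply/eqP; apply: contraT => c0.
have := H (- (y + 1) / (2 * c)).
have -> : 2 * (- (y + 1) / (2 * c)) * c + y = - 1 by field.
by rewrite lerNr oppr0 ler10.
Qed.

(** Gram-Schmidt in the order [X3], [X2], [X1]. As [U] is orthogonal to [X3], the coefficients [b]
    and [e] are computed independently of each other. *)
Lemma gaussian_regression X1 X2 X3 : jointly_gaussian P X1 X2 X3 ->
  0 < \int[P]_w (X3 w ^+ 2) ->
  exists U V b e beta, [/\ jointly_gaussian P X3 U V /\
    (\int[P]_w (X3 w * U w) = 0),
    \int[P]_w (X3 w * V w) = 0,
    \int[P]_w (U w * V w) = 0,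
    forall w, X2 w = beta * X3 w + U w &
    forall w, X1 w = b * X3 w + e * U w + V w].
Proof.
move=> g v0; set v := \int[P]_w (X3 w ^+ 2) in v0.
have vn0 : v != 0 by rewrite gt_eqF.
pose beta := \int[P]_w (X2 w * X3 w) / v.
pose U := fun w => 0 * X1 w + 1 * X2 w + (- beta) * X3 w.
pose u := \int[P]_w (U w ^+ 2).
pose b := \int[P]_w (X1 w * X3 w) / v.
pose e := \int[P]_w (U w * X1 w) / u.
have g1 : jointly_gaussian P U X1 X3.
  have := jointly_gaussian_linear 0 1 (- beta) 1 0 0 0 0 1 g.
  by congr (jointly_gaussian P); apply/funext => w; rewrite /U; ring.
pose V := fun w => (- e) * U w + 1 * X1 w + (- b) * X3 w.
have X3E w : X3 w = 0 * X1 w + 0 * X2 w + 1 * X3 w by ring.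
have X3E1 w : X3 w = 0 * U w + 0 * X1 w + 1 * X3 w by ring.
have UE1 w : U w = 1 * U w + 0 * X1 w + 0 * X3 w by ring.
have XU0 : \int[P]_w (X3 w * U w) = 0.
  transitivity (\int[P]_w ((0 * X1 w + 0 * X2 w + 1 * X3 w) *
      (0 * X1 w + 1 * X2 w + (- beta) * X3 w))).
    by apply: eq_Rintegral => w _; rewrite -X3E.
  rewrite Rintegral_bilinear// -/v.
  transitivity (\int[P]_w (X2 w * X3 w) - beta * v); first by ring.
  by rewrite divfK// subrr.
have UX0 : \int[P]_w (U w * X3 w) = 0.
  by rewrite -[RHS]XU0; apply: eq_Rintegral => w _; rewrite mulrC.
have XV0 : \int[P]_w (X3 w * V w) = 0.
  transitivity (\int[P]_w ((0 * U w + 0 * X1 w + 1 * X3 w) *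
      ((- e) * U w + 1 * X1 w + (- b) * X3 w))).
    by apply: eq_Rintegral => w _; rewrite -X3E1.
  rewrite Rintegral_bilinear// -/v UX0.
  transitivity (\int[P]_w (X1 w * X3 w) - b * v); first by ring.
  by rewrite divfK// subrr.
have UV0 : \int[P]_w (U w * V w) = 0.
  transitivity (\int[P]_w ((1 * U w + 0 * X1 w + 0 * X3 w) *
      ((- e) * U w + 1 * X1 w + (- b) * X3 w))).
    by apply: eq_Rintegral => w _; rewrite -UE1.
  rewrite Rintegral_bilinear// -/v UX0 -/u.
  transitivity (\int[P]_w (U w * X1 w) - e * u); first by ring.
  (* If [u = 0], then [e = 0] since division by zero gives zero. *)
  have [u0|u0] := eqVneq u 0; last by rewrite divfK// subrr.
  by rewrite u0 mulr0 subr0; exact: gaussian_sqr_eq0_cov g1 u0.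
exists U, V, b, e, beta; split => //.
- split => //.
  have := jointly_gaussian_linear 0 0 1 1 0 0 (- e) 1 (- b) g1.
  congr (jointly_gaussian P) => //; apply/funext => w; ring.
- by move=> w; rewrite /U; ring.
- by move=> w; rewrite /V; ring.
Qed.
End covariance.

(** * The inequality and its equality case *)

Section inequality.
Context d (T : measurableType d) (R : realType) (P : probability T R).
Variables X1 X2 X3 : T -> R.
Hypothesis g : jointly_gaussian P X1 X2 X3.
Hypothesis v1_gt0 : 0 < \int[P]_w (X1 w ^+ 2).
Hypothesis v2_gt0 : 0 < \int[P]_w (X2 w ^+ 2).
Hypothesis v3_gt0 : 0 < \int[P]_w (X3 w ^+ 2).
Variable j : nat.
Hypothesis j_gt0 : (0 < j)%N.
Local Notation N := (j.*2%:R : R).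

(* p is 4 or 6 and c the p-th moment of the standard normal law *)
Let product_inequality (p : nat) (c : R) (cA cB cD cW : R -> R -> R -> R) :
  (p < 9)%N -> 0 < c ->
  (forall s, gaussian_moment s p = c * s ^+ p./2) ->
  (forall x u, 0 <= x -> 0 <= u -> 0 < x + u ->
    [/\ 0 < cA N x u, 0 <= cW N x u, cW N x u = 0 -> x = 0 &
      0 < cA N x u * cB N x u - x * u * cD N x u ^+ 2]) ->
  (forall X U V (b e beta : R), jointly_gaussian P X U V ->
    \int[P]_w (X w * U w) = 0 -> \int[P]_w (X w * V w) = 0 ->
    \int[P]_w (U w * V w) = 0 ->
    let v := \int[P]_w (X w ^+ 2) in let u := \int[P]_w (U w ^+ 2) in
    let t := \int[P]_w (V w ^+ 2) in let x := beta ^+ 2 * v in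
    \int[P]_w ((b * X w + e * U w + V w) ^+ 2 * (beta * X w + U w) ^+ p *
               X w ^+ j.*2) =
    \int[P]_w (X w ^+ j.*2) *
    (c * (b ^+ 2 * v + e ^+ 2 * u + t) * (x + u) ^+ p./2 +
     (t * cW N x u + b ^+ 2 * v * cA N x u + e ^+ 2 * u * cB N x u
      + 2 * b * e * beta * v * u * cD N x u))) ->
  let lhs := \int[P]_w (X1 w ^+ 2) * \int[P]_w (X2 w ^+ p) *
    \int[P]_w (X3 w ^+ j.*2) in
  let rhs := \int[P]_w (X1 w ^+ 2 * X2 w ^+ p * X3 w ^+ j.*2) in
  lhs <= rhs /\ (rhs = lhs -> [/\ \int[P]_w (X1 w * X2 w) = 0,
    \int[P]_w (X1 w * X3 w) = 0 & \int[P]_w (X2 w * X3 w) = 0]).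
Proof.
move=> p9 c0 momE coefP form lhs rhs.
have [U [V [b [e [beta [[gX XU0] XV0 UV0 X2E X1E]]]]]] :=
  gaussian_regression g v3_gt0.
pose v := \int[P]_w (X3 w ^+ 2); have v0 : 0 < v := v3_gt0.
pose u := \int[P]_w (U w ^+ 2); pose t := \int[P]_w (V w ^+ 2).
have M0 := even_moment_gt0 j (jointly_gaussian3 g) v3_gt0.
set M := \int[P]_w (X3 w ^+ j.*2) in M0 *.
have bil (a1 a2 a3 b1 b2 b3 : R) :
    \int[P]_w ((a1 * X3 w + a2 * U w + a3 * V w) *
      (b1 * X3 w + b2 * U w + b3 * V w)) = a1 * b1 * v + a2 * b2 * u + a3 * b3 * t.
  by rewrite Rintegral_bilinear// XU0 XV0 UV0 -/v -/u -/t; ring.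
have v1E : \int[P]_w (X1 w ^+ 2) = b ^+ 2 * v + e ^+ 2 * u + t.
  have := bil b e 1 b e 1.
  rewrite -[b * b]expr2 -[e * e]expr2 !mul1r => <-.
  by apply: eq_Rintegral => w _; rewrite X1E; ring.
have v2E : \int[P]_w (X2 w ^+ 2) = beta ^+ 2 * v + u.
  have := bil beta 1 0 beta 1 0.
  rewrite -[beta * beta]expr2 !mul1r !mul0r addr0 => <-.
  by apply: eq_Rintegral => w _; rewrite X2E; ring.
have c12 : \int[P]_w (X1 w * X2 w) = b * beta * v + e * u.
  have := bil b e 1 beta 1 0; rewrite mulr1 mulr0 mul0r addr0 => <-.
  by apply: eq_Rintegral => w _; rewrite X1E X2E; ring.
have c13 : \int[P]_w (X1 w * X3 w) = b * v.
  have := bil b e 1 1 0 0; rewrite mulr1 !mulr0 !mul0r !addr0 => <-.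
  by apply: eq_Rintegral => w _; rewrite X1E; ring.
have c23 : \int[P]_w (X2 w * X3 w) = beta * v.
  have := bil beta 1 0 1 0 0; rewrite mulr1 !mulr0 !mul0r !addr0 => <-.
  by apply: eq_Rintegral => w _; rewrite X2E; ring.
have u0 : 0 <= u by apply: Rintegral_ge0 => w _; exact: sqr_ge0.
have t0 : 0 <= t by apply: Rintegral_ge0 => w _; exact: sqr_ge0.
pose x := beta ^+ 2 * v.
have x0 : 0 <= x by rewrite mulr_ge0 ?sqr_ge0// ltW.
have xu0 : 0 < x + u by rewrite -v2E.
have [A0 W0 W0x det0] := coefP x u x0 u0 xu0.
pose Q := t * cW N x u + b ^+ 2 * v * cA N x u + e ^+ 2 * u * cB N x u
      + 2 * b * e * beta * v * u * cD N x u.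
have rhsE : rhs = lhs + M * Q.
  have := form X3 U V b e beta gX XU0 XV0 UV0; rewrite -/v -/u -/t -/x -/M -/Q.
  rewrite /lhs (gaussian_momentE (jointly_gaussian2 g) p9) momE v1E v2E -/x -/M.
  move=> formE; transitivity (M * (c * (b ^+ 2 * v + e ^+ 2 * u + t) *
      (x + u) ^+ p./2 + Q)); last by ring.
  rewrite -formE /rhs; apply: eq_Rintegral => w _.
  by rewrite -X1E -X2E.
have [Q0 Qeq] := @moment_form_ge0 R v u t b e beta _ _ _ _ v0 u0 t0 A0 W0 det0.
rewrite rhsE; split; first by rewrite lerDl mulr_ge0// ltW.
move/eqP; rewrite -subr_eq0 addrAC subrr add0r mulf_eq0 (gt_eqF M0)/= => /eqP.
move=> /Qeq[tW b0 eu0].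
(* With [b = 0] and [e u = 0] the variance of [X1] is that of [V]. Hence [t > 0], and [t W = 0] then
   forces [x = 0], that is [beta = 0]. *)
have tg : 0 < t.
  have : 0 < b ^+ 2 * v + e ^+ 2 * u + t by rewrite -v1E.
  have -> : b ^+ 2 * v + e ^+ 2 * u + t = b * (b * v) + e * (e * u) + t by ring.
  by rewrite b0 eu0 mul0r mulr0 !add0r.
have beta0 : beta = 0.
  move/eqP: tW; rewrite mulf_eq0 (gt_eqF tg)/= => /eqP /W0x /eqP.
  by rewrite mulf_eq0 (gt_eqF v0) orbF sqrf_eq0 => /eqP.
by rewrite c12 c13 c23 b0 beta0 eu0 !mul0r addr0.
Qed.

Let N_gt0 : 0 < N. Proof. by rewrite ltr0n double_gt0. Qed.

Lemma product_inequality4 :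
  let lhs := \int[P]_w (X1 w ^+ 2) * \int[P]_w (X2 w ^+ 4) *
    \int[P]_w (X3 w ^+ j.*2) in
  let rhs := \int[P]_w (X1 w ^+ 2 * X2 w ^+ 4 * X3 w ^+ j.*2) in
  lhs <= rhs /\ (rhs = lhs -> [/\ \int[P]_w (X1 w * X2 w) = 0,
    \int[P]_w (X1 w * X3 w) = 0 & \int[P]_w (X2 w * X3 w) = 0]).
Proof.
apply: (@product_inequality 4 3 (@coefA4 R) (@coefB4 R) (@coefD4 R) (@coefW4 R)) => //.
- move=> x u x0 u0 xu0; split.
  + exact: coefA4_gt0.
  + exact: coefW4_ge0.
  + exact: coefW4_eq0.
  + exact: det4_gt0.
- by move=> X U V b e beta gX XU0 XV0 UV0 v u t x; exact: Rintegral_gaussian_form4.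
Qed.

Lemma product_inequality6 :
  let lhs := \int[P]_w (X1 w ^+ 2) * \int[P]_w (X2 w ^+ 6) *
    \int[P]_w (X3 w ^+ j.*2) in
  let rhs := \int[P]_w (X1 w ^+ 2 * X2 w ^+ 6 * X3 w ^+ j.*2) in
  lhs <= rhs /\ (rhs = lhs -> [/\ \int[P]_w (X1 w * X2 w) = 0,
    \int[P]_w (X1 w * X3 w) = 0 & \int[P]_w (X2 w * X3 w) = 0]).
Proof.
apply: (@product_inequality 6 15 (@coefA6 R) (@coefB6 R) (@coefD6 R) (@coefW6 R)) => //.
- move=> x u x0 u0 xu0; split.
  + exact: coefA6_gt0.
  + exact: coefW6_ge0.
  + exact: coefW6_eq0.
  + exact: det6_gt0.
- by move=> X U V b e beta gX XU0 XV0 UV0 v u t x; exact: Rintegral_gaussian_form6.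
Qed.
End inequality.

(** * Independence *)

Section indicators.
Context {R : realType}.

(** A second family of generators: for independent variables the product rule is given on
    indicators, and the covariances are reached once the closure contains the identity. *)
Definition indicators : set (R -> R) :=
  [set f | exists2 A : set R, measurable A & f = \1_A].

Local Notation closure := (dominated_closure indicators).

Lemma indicators_poly_dominated : indicators `<=` poly_dominated.
Proof.
move=> _ [A mA ->]; split; first exact: measurable_indic.
by exists 1, 0%N => x; rewrite expr0 mulr1 indicE; case: (_ \in _);
  rewrite ?normr1 ?normr0.
Qed.

Lemma indicators1 : indicators (cst 1).
Proof. by exists setT => //; rewrite indicT. Qed.

Lemma closure_nnsfun (h : {nnsfun R >-> R}) : closure h.
Proof.
have -> : (h : R -> R) = (fun x =>
    \sum_(y <- finmap.enum_fset (fset_set (range h))) (y * \1_(h @^-1` [set y]) x)).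
  by apply/funext => x; rewrite {1}fimfunE fsbig_finite.
elim: (finmap.enum_fset _) => [|y s IHs].
  have := closure_cst indicators1 0.
  by congr dominated_closure; apply/funext => x; rewrite big_nil.
have hy : closure (\1_(h @^-1` [set y])).
  by apply: Closure_gen; exists (h @^-1` [set y]).
have := Closure_lin y hy IHs.
by congr dominated_closure; apply/funext => x; rewrite big_cons.
Qed.

(** The approximating simple functions stay below [f], so they inherit its polynomial bound and
    [Closure_lim] applies. *)
Lemma closure_nneg (f : R -> R) C k : measurable_fun setT f ->
  (forall x, 0 <= f x) -> (forall x, f x <= C * (1 + x ^+ 2) ^+ k) -> closure f.
Proof.
move=> mf f0 fC.
have mfe : measurable_fun setT (EFin \o f) by exact/measurable_EFinP.
have f0e x : setT x -> (0 <= (EFin \o f) x)%E by rewrite lee_fin.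
pose a n := nnsfun_approx measurableT mfe n.
apply: (@Closure_lim _ _ (fun n => a n) _ C k).
- by move=> n; exact: closure_nnsfun.
- move=> n x; rewrite ger0_norm// (le_trans _ (fC x))//.
  rewrite -lee_fin; have := le_approx n f0e (I : setT x).
  by rewrite -nnsfun_approxE.
- by move=> x; have /fine_cvg := cvg_nnsfun_approx measurableT mfe f0e (I : setT x).
Qed.

Lemma closure_indicators_id : closure id.
Proof.
have max0 (x : R) : `|Num.max x 0| <= 1 + x ^+ 2.
  rewrite ger0_norm ?le_max ?lexx ?orbT// ge_max addr_ge0 ?sqr_ge0// andbT.
  by have := sqr_ge0 (x - 1); have := sqr_ge0 x; lra.
have hp : closure (fun x => Num.max x 0).
  apply: (@closure_nneg _ 1 1).
  - by apply: measurable_maxr => //; exact: measurable_id.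
  - by move=> x; rewrite le_max lexx orbT.
  - by move=> x; rewrite mul1r expr1 (le_trans (ler_norm _)).
have hn : closure (fun x => Num.max (- x) 0).
  apply: (@closure_nneg _ 1 1).
  - apply: measurable_maxr => //; apply: measurableT_comp => //.
  - by move=> x; rewrite le_max lexx orbT.
  - move=> x; rewrite mul1r expr1 (le_trans (ler_norm _))//.
    by rewrite (le_trans (max0 _))// sqrrN.
have := Closure_lin (-1) hn hp.
congr dominated_closure; apply/funext => x.
by case: (ltrgt0P x) => x0; rewrite ?x0 /Num.max ?oppr_lt0 ?oppr0 ?ltxx
  ?x0 ?(lt_gtF x0) ?oppr_gt0; lra.
Qed.
End indicators.

Section independence.
Context d (T : measurableType d) (R : realType) (P : probability T R).
Variables X1 X2 X3 : {RV P >-> R}.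
Local Notation X := (tnth [tuple X1; X2; X3]).

Lemma tnth3E : [/\ X ord0 = X1, X (lift ord0 ord0) = X2 &
  X (lift ord0 (lift ord0 ord0)) = X3].
Proof. by rewrite !(tnth_nth X1). Qed.

Lemma probability_Rintegral_indic (A : set T) : measurable A ->
  P A = (\int[P]_w \1_A w)%:E.
Proof.
move=> mA; rewrite /Rintegral integral_indic// setIT fineK//.
exact: fin_num_measure.
Qed.

Hypothesis g : jointly_gaussian P X1 X2 X3.

Lemma uncorrelated_independent_rvs :
  \int[P]_w (X1 w * X2 w) = 0 -> \int[P]_w (X1 w * X3 w) = 0 ->
  \int[P]_w (X2 w * X3 w) = 0 -> independent_rvs P X.
Proof.
move=> c12 c13 c23 J A mA.
have [E1 E2 E3] := tnth3E.
(* Taking the whole line outside [J] reduces the product rule for a subfamily to that of the full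
   triple. *)
pose B (i : 'I_3) : set R := if i \in J then A i else setT.
have mB i : measurable (B i) by rewrite /B; case: ifP.
have -> : \bigcap_(i in [set` J]) (X i @^-1` A i) =
    X1 @^-1` B ord0 `&` X2 @^-1` B (lift ord0 ord0) `&`
    X3 @^-1` B (lift ord0 (lift ord0 ord0)).
  rewrite -E1 -E2 -E3; apply/seteqP; split => w /=.
    by move=> H; split; [split|]; rewrite /B; case: ifP => // iJ; exact: H.
  move=> [[H1 H2] H3] i iJ.
  have : B i (X i w).
    by case: i iJ => -[|[|[|//]]] i3 iJ; [move: H1|move: H2|move: H3];
      congr (B _ (X _ _)); exact: val_inj.
  by rewrite /B; have -> : i \in J by [].
rewrite (prob_uncorrelated_factor g c12 c13 c23)//.
rewrite big_mkcond/= !big_ord_recl big_ord0 mule1 muleA E1 E2 E3.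
by congr (_ * _ * _)%E; rewrite /B; case: ifP => //;
  rewrite preimage_setT probability_setT.
Qed.

(** The product rule for the full triple factorises indicators, and the closure extends this to
    identities and constants. Each covariance is then a product of means, which vanish. *)
Lemma independent_rvs_uncorrelated : independent_rvs P X ->
  [/\ \int[P]_w (X1 w * X2 w) = 0, \int[P]_w (X1 w * X3 w) = 0 &
    \int[P]_w (X2 w * X3 w) = 0].
Proof.
move=> ind; have [E1 E2 E3] := tnth3E.
have all_m (Y : T -> R) : gaussian_moments P Y -> all_moments P Y.
  by case=> mY iY _ _; split.
have g1 := jointly_gaussian1 g; have g2 := jointly_gaussian2 g.
have g3 := jointly_gaussian3 g.
have fact : forall f1 f2 f3 : R -> R,
    indicators f1 -> indicators f2 -> indicators f3 ->
    \int[P]_w (f1 (X1 w) * f2 (X2 w) * f3 (X3 w)) =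
    \int[P]_w f1 (X1 w) * \int[P]_w f2 (X2 w) * \int[P]_w f3 (X3 w).
  move=> _ _ _ [A mA ->] [B mB ->] [C mC ->].
  pose D (i : 'I_3) : set R := tnth [tuple A; B; C] i.
  have mD i : measurable (D i).
    by rewrite /D; case: i => -[|[|[|]]].
  have mpre (Y : {RV P >-> R}) (S : set R) : measurable S -> measurable (Y @^-1` S).
    by move=> mS; rewrite -[X in measurable X]setTI; exact: measurable_funPT.
  pose J := [set: 'I_3]%SET; have := ind J D mD.
  have -> : \bigcap_(i in [set` J]) (X i @^-1` D i) =
      X1 @^-1` A `&` X2 @^-1` B `&` X3 @^-1` C.
    apply/seteqP; split => w /=.
      move=> H; have in3 (i : 'I_3) : i \in J by rewrite inE.
      split; [split|].
      - by have := H ord0 (in3 _); rewrite E1.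
      - by have := H (lift ord0 ord0) (in3 _); rewrite E2.
      - by have := H (lift ord0 (lift ord0 ord0)) (in3 _); rewrite E3.
    by move=> [[H1 H2] H3] -[[|[|[|//]]] i3] _; rewrite /D !(tnth_nth X1, tnth_nth A).
  rewrite (eq_bigl xpredT); last by move=> i; rewrite inE.
  rewrite !big_ord_recl big_ord0 mule1 muleA E1 E2 E3.
  rewrite /D !(tnth_nth A)/= !probability_Rintegral_indic//; try exact: mpre;
    last by do 2 (apply: measurableI; try exact: mpre).
  rewrite -!EFinM => -[h].
  have pre (Y : T -> R) (S : set R) w : \1_(Y @^-1` S) w = \1_S (Y w) :> R.
    by rewrite !indicE; congr (_%:R); apply/idP/idP; rewrite !inE.
  transitivity (\int[P]_w (\1_(X1 @^-1` A `&` X2 @^-1` B `&` X3 @^-1` C) w : R)).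
    by apply: eq_Rintegral => w _; rewrite !indicI /= !pre.
  rewrite h; congr (_ * _ * _); apply: eq_Rintegral => w _; exact: pre.
have F := Rintegral_closure_factor3 indicators_poly_dominated
  (all_m _ g1) (all_m _ g2) (all_m _ g3) fact.
have hid := @closure_indicators_id R.
have h1 := closure_cst (@indicators1 R) 1.
have [_ _ m1 _] := g1; have [_ _ m2 _] := g2; have [_ _ m3 _] := g3.
split.
- have := F _ _ _ hid hid h1; rewrite /= m1 !mul0r => <-.
  by apply: eq_Rintegral => w _; rewrite mulr1.
- have := F _ _ _ hid h1 hid; rewrite /= m1 !mul0r => <-.
  by apply: eq_Rintegral => w _; rewrite mulr1.
- have := F _ _ _ h1 hid hid; rewrite /= m3 !mulr0 => <-.
  by apply: eq_Rintegral => w _; rewrite mul1r.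
Qed.
End independence.

(** * From Gaussian vectors to moment conditions *)

Section gaussian_vector3.
Context d (T : measurableType d) (R : realType) (P : probability T R).
Variables X1 X2 X3 : {RV P >-> R}.
Local Notation X := (tnth [tuple X1; X2; X3]).

(** A linear combination is Gaussian by hypothesis, but its mean must be shown to vanish, which
    needs integrable components. This comes from the combinations with Kronecker coefficients, which
    are the components themselves. *)
Lemma gaussian_vector_jointly_gaussian :
  gaussian_vector P X -> centered_vector P X -> jointly_gaussian P X1 X2 X3.
Proof.
move=> gX cX; have [E1 E2 E3] := tnth3E X1 X2 X3.
have sumE (a : 'I_3 -> R) w : (\sum_(i < 3) a i *: X i : {mfun T >-> R}) w =
    a ord0 * X1 w + a (lift ord0 ord0) * X2 w +
    a (lift ord0 (lift ord0 ord0)) * X3 w.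
  by rewrite !big_ord_recl big_ord0 E1 E2 E3 /= addr0 addrA.
have gY (a : 'I_3 -> R) (Y : {RV P >-> R}) :
    (forall w, Y w = (\sum_(i < 3) a i *: X i : {mfun T >-> R}) w) ->
    gaussian_rv P Y.
  move=> YE; have -> : Y = (\sum_(i < 3) a i *: X i : {mfun T >-> R}) by exact/mfuneqP.
  exact: gX.
have mean (i : 'I_3) : gaussian_moments P (X i).
  apply: gaussian_rv_moments (cX i).
  pose a (k : 'I_3) : R := (k == i)%:R; apply: (gY a) => w.
  rewrite sumE /a; move: i {a} => [[|[|[|//]]] i3]; rewrite /= !(tnth_nth X1) /=; ring.
have i1 : P.-integrable setT (EFin \o X1).
  have [_ + _ _] := mean ord0; rewrite E1 => /(_ 1%N).
  by under [X in EFin \o X]eq_fun do rewrite expr1.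
have i2 : P.-integrable setT (EFin \o X2).
  have [_ + _ _] := mean (lift ord0 ord0); rewrite E2 => /(_ 1%N).
  by under [X in EFin \o X]eq_fun do rewrite expr1.
have i3 : P.-integrable setT (EFin \o X3).
  have [_ + _ _] := mean (lift ord0 (lift ord0 ord0)); rewrite E3 => /(_ 1%N).
  by under [X in EFin \o X]eq_fun do rewrite expr1.
have m1 : \int[P]_w X1 w = 0 by have [_ _ + _] := mean ord0; rewrite E1.
have m2 : \int[P]_w X2 w = 0.
  by have [_ _ + _] := mean (lift ord0 ord0); rewrite E2.
have m3 : \int[P]_w X3 w = 0.
  by have [_ _ + _] := mean (lift ord0 (lift ord0 ord0)); rewrite E3.
move=> a b c.
pose f (k : 'I_3) : R := tnth [tuple a; b; c] k.
pose Y : {RV P >-> R} := (\sum_(i < 3) f i *: X i : {mfun T >-> R}).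
have YE : (Y : T -> R) = (fun w => a * X1 w + b * X2 w + c * X3 w).
  by apply/funext => w; rewrite /Y sumE /f !(tnth_nth a).
rewrite -YE; apply: gaussian_rv_moments; first exact: gX.
have ia := integrableZl measurableT a i1.
have ib := integrableZl measurableT b i2.
have ic := integrableZl measurableT c i3.
have iab := integrableD measurableT ia ib.
have iabc := integrableD measurableT iab ic.
have iY : P.-integrable setT (EFin \o Y) by rewrite YE.
rewrite unlock -[LHS]fineK; last exact: integrable_fin_num iY.
rewrite -/(Rintegral P setT Y) YE.
by rewrite RintegralD// RintegralD// !RintegralZl// m1 m2 m3 !mulr0 !addr0.
Qed.
End gaussian_vector3.

Section expectation.
Context d (T : measurableType d) (R : realType) (P : probability T R).

Lemma expectationE (f : T -> R) : P.-integrable setT (EFin \o f) ->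
  'E_P[f]%E = (\int[P]_w f w)%:E.
Proof. by move=> intf; rewrite unlock /Rintegral fineK//; exact: integrable_fin_num. Qed.

Lemma variance_gt0_sqr (Y : {RV P >-> R}) : gaussian_moments P Y ->
  (0 < 'V_P[Y])%E -> 0 < \int[P]_w (Y w ^+ 2).
Proof.
move=> [mY iY Y0 _].
have i1 : P.-integrable setT (EFin \o Y).
  by have := iY 1%N; under [X in EFin \o X]eq_fun do rewrite expr1.
have EY : 'E_P[Y]%E = 0%E by rewrite expectationE// Y0.
rewrite /variance covariance.unlock EY/=.
have -> : ((Y \- cst 0) * (Y \- cst 0))%R = (fun w => Y w ^+ 2).
  by apply/funext => w; rewrite mulrfctE /= subr0 expr2.
by rewrite expectationE// lte_fin.
Qed.
End expectation.

Theorem theorem3p5 (R : realType) (d : measure_display) (T : measurableType d)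
    (P : probability T R) (m3 : nat) (hm3 : (0 < m3)%N)
    (X1 X2 X3 : {RV P >-> R})
    (hgauss : gaussian_vector P (tnth [tuple X1; X2; X3]))
    (hcentered : centered_vector P (tnth [tuple X1; X2; X3]))
    (hnondeg : nondegenerate_vector P (tnth [tuple X1; X2; X3])) :
  [/\ ('E_P[fun w => (X1 w ^+ 2)%R] * 'E_P[fun w => (X2 w ^+ 4)%R]
         * 'E_P[fun w => (X3 w ^+ (2 * m3))%R]
       <= 'E_P[fun w => (X1 w ^+ 2 * X2 w ^+ 4 * X3 w ^+ (2 * m3))%R])%E,
      ('E_P[fun w => (X1 w ^+ 2 * X2 w ^+ 4 * X3 w ^+ (2 * m3))%R]
       = 'E_P[fun w => (X1 w ^+ 2)%R] * 'E_P[fun w => (X2 w ^+ 4)%R]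
         * 'E_P[fun w => (X3 w ^+ (2 * m3))%R])%E
        <-> independent_rvs P (tnth [tuple X1; X2; X3]),
      ('E_P[fun w => (X1 w ^+ 2)%R] * 'E_P[fun w => (X2 w ^+ 6)%R]
         * 'E_P[fun w => (X3 w ^+ (2 * m3))%R]
       <= 'E_P[fun w => (X1 w ^+ 2 * X2 w ^+ 6 * X3 w ^+ (2 * m3))%R])%E
    & ('E_P[fun w => (X1 w ^+ 2 * X2 w ^+ 6 * X3 w ^+ (2 * m3))%R]
       = 'E_P[fun w => (X1 w ^+ 2)%R] * 'E_P[fun w => (X2 w ^+ 6)%R]
         * 'E_P[fun w => (X3 w ^+ (2 * m3))%R])%E
        <-> independent_rvs P (tnth [tuple X1; X2; X3])].
Proof.
have [E1 E2 E3] := tnth3E X1 X2 X3.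
have g := gaussian_vector_jointly_gaussian hgauss hcentered.
have g1 := jointly_gaussian1 g; have g2 := jointly_gaussian2 g.
have g3 := jointly_gaussian3 g.
have v1 : 0 < \int[P]_w (X1 w ^+ 2).
  by apply: variance_gt0_sqr g1 _; have := hnondeg ord0; rewrite E1.
have v2 : 0 < \int[P]_w (X2 w ^+ 2).
  apply: variance_gt0_sqr g2 _.
  by have := hnondeg (lift ord0 ord0); rewrite E2.
have v3 : 0 < \int[P]_w (X3 w ^+ 2).
  apply: variance_gt0_sqr g3 _.
  by have := hnondeg (lift ord0 (lift ord0 ord0)); rewrite E3.
have [_ i1 _ _] := g1; have [_ i2 _ _] := g2; have [_ i3 _ _] := g3.
rewrite mul2n !expectationE//; try exact: (integrable_monomial g).
have indepP p : let lhs := \int[P]_w (X1 w ^+ 2) * \int[P]_w (X2 w ^+ p) *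
      \int[P]_w (X3 w ^+ m3.*2) in
    let rhs := \int[P]_w (X1 w ^+ 2 * X2 w ^+ p * X3 w ^+ m3.*2) in
    (rhs = lhs -> [/\ \int[P]_w (X1 w * X2 w) = 0,
      \int[P]_w (X1 w * X3 w) = 0 & \int[P]_w (X2 w * X3 w) = 0]) ->
    rhs%:E = lhs%:E <-> independent_rvs P (tnth [tuple X1; X2; X3]).
  (* Both implications pass through the covariances: once they vanish, the laws factorise, and so do
     the monomials, which gives equality for every [p]. *)
  move=> lhs rhs H; split=> [[/H[c12 c13 c23]]|/(independent_rvs_uncorrelated g)].
    exact: uncorrelated_independent_rvs.
  move=> [c12 c13 c23]; congr EFin.
  exact: monomial_uncorrelated_factor.
have [le4 eq4] := product_inequality4 g v1 v2 v3 hm3.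
have [le6 eq6] := product_inequality6 g v1 v2 v3 hm3.
rewrite -!EFinM !lee_fin; split => //; exact: indepP.
Qed.
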